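(* We have $$\frac{\varphi(e^{-49\pi})}{\varphi(e^{-\pi})} = \frac{1}{7}(1 + u + v + w),$$ where $$u = \left(\frac{\alpha^2 p}{\beta}\right)^{1/7}, \quad v = \left(\frac{\beta^2 p}{\gamma}\right)^{1/7}, \quad w = \left(\frac{\gamma^2 p}{\alpha}\right)^{1/7},$$ and $$p = \sqrt{7} + \sqrt{2}\cdot 7^{1/4} + 1,$$ $$\alpha = \frac{1}{\sqrt{7}}\left\{\frac{2}{3}\big(\sqrt{7} + 2\big)\big(5 + 3\sqrt{2}\cdot7^{1/4} - \sqrt{7}\big) + 2\big(\sqrt{7} - 1\big)\big(1 - \sqrt{2}\cdot7^{1/4} + \sqrt{7}\big)\cos\left(\frac{\pi}{7}\right) + \frac{2}{3}\big(\sqrt{7} - 1\big)\big(3\sqrt{2}\cdot 7^{1/4} - \sqrt{7} - 1\big)\cos\left(\frac{2\pi}{7}\right)\right\},$$ $$\beta = \frac{1}{\sqrt{7}}\left\{\frac{1}{9}\big(\sqrt{7} + 5\big)\big(13 + 9\sqrt{2}\cdot 7^{1/4} + \sqrt{7}\big) - 8\cos\left(\frac{\pi}{7}\right) + 2\big(\sqrt{7} - 1\big)\big(1 - \sqrt{2}\cdot 7^{1/4} + \sqrt{7}\big)\cos\left(\frac{2\pi}{7}\right)\right\},$$ $$\gamma = \frac{1}{\sqrt{7}}\left\{\frac{1}{3}\big(\sqrt{7} + 5\big)\big(1 + 3\sqrt{2}\cdot 7^{1/4} + \sqrt{7}\big) + \frac{2}{3}\big(\sqrt{7} - 1\big)\big(3\sqrt{2}\cdot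 7^{1/4} - \sqrt{7} - 1\big)\cos\left(\frac{\pi}{7}\right) - 8\cos\left(\frac{2\pi}{7}\right)\right\}.$$
   Context: For $|q|<1$, Ramanujan's theta function is $\varphi(q) := \sum_{n=-\infty}^{\infty} q^{n^2}$. Fractional powers of positive real numbers are the positive real ones. *)

(* Defs.v *)
From Stdlib Require Import Reals ZArith Lra Lia Psatz.
From Coquelicot Require Import Coquelicot.
Open Scope R_scope.

(* The sum over all integers, split as (n >= 0) + (n < 0).  [Series] is a total
   function, so this is meaningful only when both halves converge. *)
Definition ex_BiSeries (a : Z -> R) : Prop :=
  ex_series (fun n : nat => a (Z.of_nat n)) /\
  ex_series (fun n : nat => a (- Z.of_nat (S n))%Z).

Definition BiSeries (a : Z -> R) : R :=
  Series (fun n : nat => a (Z.of_nat n)) +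
  Series (fun n : nat => a (- Z.of_nat (S n))%Z).

Definition phi (q : R) : R := BiSeries (fun n : Z => powerRZ q (n ^ 2)%Z).

Lemma phi_summand_le (q : R) (n : nat) (z : Z) :
  Rabs q < 1 -> Z.abs z = Z.of_nat n -> Rabs (powerRZ q (z ^ 2)%Z) <= Rabs q ^ n.
Proof.
intros Hq Hz.
assert (Hsq : (z ^ 2 = Z.of_nat (n * n))%Z) by nia.
rewrite Hsq, <- pow_powerRZ, <- RPow_abs.
destruct n as [|n]; [simpl; lra|].
assert (H0 := Rabs_pos q).
replace (S n * S n)%nat with (S n + n * S n)%nat by lia.
rewrite pow_add.
assert (H1 : 0 <= Rabs q ^ S n) by (apply pow_le; lra).
assert (H2 : 0 <= Rabs q ^ (n * S n) <= 1).
{ split; [apply pow_le; lra|].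
  rewrite <- (pow1 (n * S n)); apply pow_incr; lra. }
nra.
Qed.

Lemma ex_phi (q : R) :
  Rabs q < 1 -> ex_BiSeries (fun n : Z => powerRZ q (n ^ 2)%Z).
Proof.
intros Hq.
assert (Hg : ex_series (fun n : nat => Rabs q ^ n)).
{ apply ex_series_geom; rewrite Rabs_Rabsolu; exact Hq. }
split.
- apply (@ex_series_le R_AbsRing R_CompleteNormedModule _ (fun n : nat => Rabs q ^ n)); [|exact Hg].
  intros n; apply (phi_summand_le q n); [exact Hq | lia].
- apply (@ex_series_le R_AbsRing R_CompleteNormedModule _ (fun n : nat => Rabs q ^ S n)).
  + intros n; apply (phi_summand_le q (S n)); [exact Hq | lia].
  + exact (proj1 (ex_series_incr_1 (fun n : nat => Rabs q ^ n)) Hg).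
Qed.

(* [Rpower] is the positive real power only for a positive base; the bases
   used with exponent 1/7 are positive by [p_pos], ..., [gamma_pos]. *)
Definition p : R := sqrt 7 + sqrt 2 * Rpower 7 (1/4) + 1.

Definition alpha : R :=
  1 / sqrt 7 *
  ( 2/3 * (sqrt 7 + 2) * (5 + 3 * sqrt 2 * Rpower 7 (1/4) - sqrt 7)
  + 2 * (sqrt 7 - 1) * (1 - sqrt 2 * Rpower 7 (1/4) + sqrt 7) * cos (PI / 7)
  + 2/3 * (sqrt 7 - 1) * (3 * sqrt 2 * Rpower 7 (1/4) - sqrt 7 - 1)
      * cos (2 * PI / 7) ).

Definition beta : R :=
  1 / sqrt 7 *
  ( 1/9 * (sqrt 7 + 5) * (13 + 9 * sqrt 2 * Rpower 7 (1/4) + sqrt 7)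
  - 8 * cos (PI / 7)
  + 2 * (sqrt 7 - 1) * (1 - sqrt 2 * Rpower 7 (1/4) + sqrt 7)
      * cos (2 * PI / 7) ).

Definition gamma : R :=
  1 / sqrt 7 *
  ( 1/3 * (sqrt 7 + 5) * (1 + 3 * sqrt 2 * Rpower 7 (1/4) + sqrt 7)
  + 2/3 * (sqrt 7 - 1) * (3 * sqrt 2 * Rpower 7 (1/4) - sqrt 7 - 1)
      * cos (PI / 7)
  - 8 * cos (2 * PI / 7) ).

Lemma sqrt7_bounds : 2.64 < sqrt 7 < 2.65.
Proof.
assert (H := sqrt_sqrt 7 ltac:(lra)); assert (H0 := sqrt_pos 7); split; nra.
Qed.

Lemma sqrt2_root4_bounds : 2.29 < sqrt 2 * Rpower 7 (1/4) < 2.31.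
Proof.
assert (Hr : Rpower 7 (1/4) * Rpower 7 (1/4) = sqrt 7).
{ rewrite <- Rpower_plus, <- Rpower_sqrt by lra; f_equal; lra. }
assert (Hp : 0 < Rpower 7 (1/4)) by apply exp_pos.
assert (H2 := sqrt_sqrt 2 ltac:(lra)).
assert (H2p := sqrt_lt_R0 2 ltac:(lra)).
assert (Ht : (sqrt 2 * Rpower 7 (1/4)) * (sqrt 2 * Rpower 7 (1/4)) = 2 * sqrt 7).
{ replace (2 * sqrt 7)
    with ((sqrt 2 * sqrt 2) * (Rpower 7 (1/4) * Rpower 7 (1/4)))
    by (rewrite H2, Hr; reflexivity).
  ring. }
assert (Htp := Rmult_lt_0_compat _ _ H2p Hp).
assert (H7 := sqrt7_bounds).
set (t := sqrt 2 * Rpower 7 (1/4)) in *.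
split; nra.
Qed.

Lemma p_pos : 0 < p.
Proof.
unfold p; assert (H := sqrt7_bounds); assert (H' := sqrt2_root4_bounds); lra.
Qed.

Lemma combination_pos (s a b c x y : R) :
  0 < s -> 0 <= b -> 0 <= c -> b + c < a -> -1 <= x <= 1 -> -1 <= y <= 1 ->
  0 < 1 / s * (a + b * x + c * y) /\ 0 < 1 / s * (a - b * x + c * y) /\
  0 < 1 / s * (a + b * x - c * y).
Proof.
intros Hs Hb Hc Ha Hx Hy.
assert (Hi : 0 < 1 / s) by (apply Rdiv_lt_0_compat; lra).
repeat split; apply Rmult_lt_0_compat; try exact Hi; nra.
Qed.

Lemma alpha_pos : 0 < alpha.
Proof.
unfold alpha; assert (H := sqrt7_bounds); assert (H' := sqrt2_root4_bounds).
rewrite !(Rmult_assoc 3 (sqrt 2)).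
set (t := sqrt 2 * Rpower 7 (1/4)) in *; set (s := sqrt 7) in *.
apply combination_pos; try apply COS_bound; try nra.
Qed.

Lemma beta_pos : 0 < beta.
Proof.
unfold beta; assert (H := sqrt7_bounds); assert (H' := sqrt2_root4_bounds).
rewrite !(Rmult_assoc 9 (sqrt 2)).
set (t := sqrt 2 * Rpower 7 (1/4)) in *; set (s := sqrt 7) in *.
apply combination_pos; try apply COS_bound; try nra.
Qed.

Lemma gamma_pos : 0 < gamma.
Proof.
unfold gamma; assert (H := sqrt7_bounds); assert (H' := sqrt2_root4_bounds).
rewrite !(Rmult_assoc 3 (sqrt 2)).
set (t := sqrt 2 * Rpower 7 (1/4)) in *; set (s := sqrt 7) in *.
apply combination_pos; try apply COS_bound; try nra.
Qed.

(* Main.v *)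
(** Write theta_s(x) for the sum over m of exp(- pi s (m + x)^2), which is
    [G s x] below.  Splitting the sum by residues modulo 7 and applying the theta
    inversion formula gives
      phi(e^(-49 pi)) / phi(e^(-pi)) = (1/7) (1 + 2 t(1/7) + 2 t(2/7) + 2 t(3/7)),
    where t(x) = theta_1(x) / theta_1(0), and the claim is that 2 t(k/7) is u, v, w
    for k = 1, 2, 3.  The only series identity used is
      theta_s(x+y) theta_s(x-y)
        = theta_2s(x) theta_2s(y) + theta_2s(x+1/2) theta_2s(y+1/2).

    Inversion: by this identity, doubling s and halving s are both steps of the
    arithmetic-geometric mean, with limits fixed by the Gaussian integral, and
    strict monotonicity of the mean does the rest.  At s = 1 the same argument
    shows that the elliptic curve is the lemniscatic one.

    Values: the square sl^2 of the (rescaled) lemniscate sine satisfies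
      sl^2(2x) = f(sl^2(x)) with f(s) = 4 s (1 - s^2) / (1 + s^2)^2, and
      t(2x) = t(x)^4 (1 + sl(x)^4).
    So the values of sl^2 at 1/7, 2/7, 4/7 = -3/7 form a 3-cycle of f, which is
    determined by the monotone branches of f it visits, since f multiplies the
    metric ds / sqrt(s (1 - s^2)) by 2.  An explicit cycle on the same branches has
    1 + s^2 = 8 beta / (alpha p), 8 gamma / (beta p), 8 alpha / (gamma p).  Then
    t(2x) = t(x)^4 (1 + sl(x)^4), read around the cycle, determines the t(k/7), and
    u/2, v/2, w/2 satisfy the same recursion because alpha beta gamma = p^4. *)

Require Import Defs.
From Stdlib Require Import Reals ZArith Lra Lia Psatz List.
From Coquelicot Require Import Coquelicot.
Import ListNotations.
Open Scope R_scope.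

(** * Unordered sums of nonnegative families *)

Definition lsum {I : Type} (f : I -> R) (L : list I) : R :=
  fold_right (fun i a => f i + a) 0 L.

(* Meaningful only for nonnegative [f]: the least upper bound of the sums over
   finite sets of indices. *)
Definition nsum {I : Type} (f : I -> R) (l : R) : Prop :=
  is_lub (fun y => exists L, NoDup L /\ y = lsum f L) l.

Lemma lsum_app {I : Type} (f : I -> R) (L M : list I) :
  lsum f (L ++ M) = lsum f L + lsum f M.
Proof. induction L as [|i L IH]; simpl; [|rewrite IH]; lra. Qed.

Lemma lsum_map {I J : Type} (g : I -> J) (f : J -> R) (L : list I) :
  lsum f (map g L) = lsum (fun i => f (g i)) L.
Proof. induction L as [|i L IH]; simpl; [|rewrite IH]; lra. Qed.

Lemma lsum_scal {I : Type} (c : R) (f : I -> R) (L : list I) :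
  lsum (fun i => c * f i) L = c * lsum f L.
Proof. induction L as [|i L IH]; simpl; [|rewrite IH]; lra. Qed.

Lemma lsum_plus {I : Type} (f g : I -> R) (L : list I) :
  lsum (fun i => f i + g i) L = lsum f L + lsum g L.
Proof. induction L as [|i L IH]; simpl; [|rewrite IH]; lra. Qed.

Lemma lsum_ext_in {I : Type} (f g : I -> R) (L : list I) :
  (forall i, In i L -> f i = g i) -> lsum f L = lsum g L.
Proof.
induction L as [|i L IH]; simpl; intros H; [reflexivity|].
rewrite IH by (intros; apply H; now right); rewrite (H i (or_introl eq_refl)); reflexivity.
Qed.

Lemma lsum_ge0 {I : Type} (f : I -> R) (L : list I) :
  (forall i, 0 <= f i) -> 0 <= lsum f L.
Proof. intros H; induction L as [|i L IH]; simpl; [|specialize (H i)]; lra. Qed.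

Lemma lsum_incl {I : Type} (f : I -> R) (L M : list I) :
  (forall i, 0 <= f i) -> NoDup L -> incl L M -> lsum f L <= lsum f M.
Proof.
intros Hf HL; revert M.
induction HL as [|i L Hi HL IH]; intros M HM; simpl; [now apply lsum_ge0|].
destruct (in_split i M (HM i (or_introl eq_refl))) as (M1 & M2 & ->).
assert (H : incl L (M1 ++ M2)).
{ intros j Hj; assert (H := HM j (or_intror Hj)).
  apply in_app_or in H; apply in_or_app.
  destruct H as [H|[H|H]]; [now left| subst; contradiction | now right]. }
specialize (IH _ H); rewrite lsum_app in *; simpl; lra.
Qed.

Lemma lsum_list_prod {I J : Type} (f : I -> R) (g : J -> R) (L : list I) (M : list J) :
  lsum (fun ij => f (fst ij) * g (snd ij)) (list_prod L M) = lsum f L * lsum g M.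
Proof.
induction L as [|i L IH]; simpl; [lra|].
rewrite lsum_app, IH, lsum_map; simpl; rewrite lsum_scal; lra.
Qed.

Lemma NoDup_prod {I J : Type} (L : list I) (M : list J) :
  NoDup L -> NoDup M -> NoDup (list_prod L M).
Proof.
intros HL HM; induction HL as [|i L Hi HL IH]; simpl; [constructor|].
apply NoDup_app; [|exact IH|].
- apply NoDup_map_NoDup_ForallPairs; [|exact HM]; intros a b _ _ E; congruence.
- intros [i' j] H H'; apply in_map_iff in H; destruct H as (j' & E & _).
  apply in_prod_iff in H'; apply Hi; replace i with i' by congruence; tauto.
Qed.

Lemma nsum_unique {I : Type} (f : I -> R) (a b : R) : nsum f a -> nsum f b -> a = b.
Proof. intros [H1 H2] [H3 H4]; apply Rle_antisym; auto. Qed.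

Lemma nsum_ub {I : Type} (f : I -> R) (a : R) (L : list I) :
  nsum f a -> NoDup L -> lsum f L <= a.
Proof. intros [H _] HL; apply H; now exists L. Qed.

Lemma nsum_least {I : Type} (f : I -> R) (a b : R) :
  nsum f a -> (forall L, NoDup L -> lsum f L <= b) -> a <= b.
Proof. intros [_ H] Hb; apply H; intros y (L & HL & ->); auto. Qed.

Lemma nsum_intro {I : Type} (f : I -> R) (a : R) :
  (forall L, NoDup L -> lsum f L <= a) ->
  (forall b, (forall L, NoDup L -> lsum f L <= b) -> a <= b) -> nsum f a.
Proof.
intros H1 H2; split.
- intros y (L & HL & ->); auto.
- intros b Hb; apply H2; intros L HL; apply Hb; now exists L.
Qed.

Lemma nsum_ext {I : Type} (f g : I -> R) (a : R) :
  (forall i, f i = g i) -> nsum f a -> nsum g a.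
Proof.
intros H Hf; assert (E : forall L, lsum f L = lsum g L)
  by (intros L; apply lsum_ext_in; auto).
apply nsum_intro.
- intros L HL; rewrite <- E; now apply nsum_ub.
- intros b Hb; apply (nsum_least f); [exact Hf|]; intros L HL; rewrite E; auto.
Qed.

(** The lower bound tests [f] and [g] on separate finite sets and passes to their union; decidable
    equality serves to remove its duplicates. *)
Lemma nsum_plus {I : Type} (dec : forall i j : I, {i = j} + {i <> j})
  (f g : I -> R) (a b : R) :
  (forall i, 0 <= f i) -> (forall i, 0 <= g i) ->
  nsum f a -> nsum g b -> nsum (fun i => f i + g i) (a + b).
Proof.
intros Hf Hg Ha Hb; apply nsum_intro.
- intros L HL; rewrite lsum_plus; apply Rplus_le_compat; now apply nsum_ub.
- intros c Hc.
  enough (a <= c - b) by lra; apply (nsum_least f); [exact Ha|]; intros L HL.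
  enough (b <= c - lsum f L) by lra; apply (nsum_least g); [exact Hb|]; intros M HM.
  assert (H := Hc (nodup dec (L ++ M)) (NoDup_nodup dec _)).
  rewrite lsum_plus in H.
  assert (H1 : lsum f L <= lsum f (nodup dec (L ++ M))).
  { apply lsum_incl; auto; intros i Hi; apply nodup_In, in_or_app; now left. }
  assert (H2 : lsum g M <= lsum g (nodup dec (L ++ M))).
  { apply lsum_incl; auto; intros i Hi; apply nodup_In, in_or_app; now right. }
  lra.
Qed.

Lemma lsum_filter {I : Type} (P : I -> bool) (f : I -> R) (L : list I) :
  (forall i, P i = false -> f i = 0) -> lsum f (filter P L) = lsum f L.
Proof.
intros H; induction L as [|i L IH]; simpl; [reflexivity|].
destruct (P i) eqn:E; simpl; rewrite IH; [|rewrite H by exact E]; lra.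
Qed.

(** Reindexing along an injection [g] with left inverse [h]: [g (h i) <> i] says that [i] lies
    outside the image of [g], where [f] must vanish. *)
Lemma nsum_inj {I J : Type} (dec : forall i j : I, {i = j} + {i <> j})
  (g : J -> I) (h : I -> J) (f : I -> R) (a : R) :
  (forall j, h (g j) = j) -> (forall i, g (h i) <> i -> f i = 0) ->
  nsum (fun j => f (g j)) a -> nsum f a.
Proof.
intros Hhg Hf Ha; apply nsum_intro.
- intros L HL.
  set (P := fun i => if dec (g (h i)) i then true else false).
  assert (HP : forall i, P i = true -> g (h i) = i)
    by (intros i; unfold P; destruct (dec (g (h i)) i); easy).
  rewrite <- (lsum_filter P); cycle 1.
  { intros i; unfold P; destruct (dec (g (h i)) i); [easy|]; auto. }
  rewrite (lsum_ext_in f (fun i => f (g (h i)))).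
  + rewrite <- (lsum_map h (fun j => f (g j))); apply nsum_ub; [exact Ha|].
    apply NoDup_map_NoDup_ForallPairs; [|now apply NoDup_filter].
    intros i j Hi Hj E; apply filter_In in Hi, Hj.
    rewrite <- (HP i), <- (HP j), E; easy.
  + intros i Hi; apply filter_In in Hi; now rewrite HP.
- intros b Hb; apply (nsum_least _ _ _ Ha); intros L HL.
  rewrite <- (lsum_map g f); apply Hb, NoDup_map_NoDup_ForallPairs; [|exact HL].
  intros i j _ _ E; rewrite <- (Hhg i), <- (Hhg j), E; reflexivity.
Qed.

(** A finite set of pairs lies in the product of its two projections. For the least bound, one
    factor at a time is replaced by its supremum, dividing by the other; a zero factor is treated
    apart. *)
Lemma nsum_prod {I J : Type} (decI : forall i j : I, {i = j} + {i <> j})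
  (decJ : forall i j : J, {i = j} + {i <> j}) (f : I -> R) (g : J -> R) (a b : R) :
  (forall i, 0 <= f i) -> (forall j, 0 <= g j) ->
  nsum f a -> nsum g b -> nsum (fun ij => f (fst ij) * g (snd ij)) (a * b).
Proof.
intros Hf Hg Ha Hb; apply nsum_intro.
- intros L HL.
  set (L1 := nodup decI (map fst L)); set (L2 := nodup decJ (map snd L)).
  apply Rle_trans with (lsum (fun ij => f (fst ij) * g (snd ij)) (list_prod L1 L2)).
  + apply lsum_incl; [|exact HL|].
    * intros ij; apply Rmult_le_pos; auto.
    * intros [i j] H; apply in_prod; apply nodup_In.
      -- apply (in_map fst _ _ H).
      -- apply (in_map snd _ _ H).
  + rewrite lsum_list_prod; apply Rmult_le_compat; try (now apply lsum_ge0);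
      apply nsum_ub; try assumption; apply NoDup_nodup.
- intros c Hc.
  assert (H : forall L M, NoDup L -> NoDup M -> lsum f L * lsum g M <= c).
  { intros L M HL HM; rewrite <- lsum_list_prod; apply Hc.
    now apply NoDup_prod. }
  assert (Hb0 : 0 <= b) by (apply (nsum_ub g b nil); [exact Hb|constructor]).
  assert (Hc0 : 0 <= c) by (specialize (H nil nil (NoDup_nil _) (NoDup_nil _)); simpl in H; lra).
  assert (H' : forall L, NoDup L -> lsum f L * b <= c).
  { intros L HL; destruct (lsum_ge0 f L Hf) as [Hp|Hz]; [|rewrite <- Hz; lra].
    rewrite Rmult_comm; apply Rle_div_r; [exact Hp|].
    apply (nsum_least g); [exact Hb|]; intros M HM; apply Rle_div_r; [exact Hp|].
    rewrite Rmult_comm; auto. }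
  destruct Hb0 as [Hp|Hz]; [|rewrite <- Hz; lra].
  apply Rle_div_r; [exact Hp|].
  apply (nsum_least f); [exact Ha|]; intros L HL; apply Rle_div_r; auto.
Qed.

Lemma sum_n_le_Series (a : nat -> R) (n : nat) :
  (forall k, 0 <= a k) -> ex_series a -> sum_n a n <= Series a.
Proof.
intros Ha [l Hl]; rewrite (is_series_unique _ _ Hl).
apply (is_lim_seq_incr_compare (sum_n a)); [exact Hl|].
intros k; rewrite sum_Sn; unfold plus; simpl; specialize (Ha (S k)); lra.
Qed.

Lemma Series_le_of_sum_n (a : nat -> R) (b : R) :
  ex_series a -> (forall n, sum_n a n <= b) -> Series a <= b.
Proof.
intros [l Hl] H; rewrite (is_series_unique _ _ Hl).
apply (is_lim_seq_le (sum_n a) (fun _ => b) l b H Hl (is_lim_seq_const b)).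
Qed.

Lemma lsum_seq (a : nat -> R) (n : nat) : lsum a (seq 0 (S n)) = sum_n a n.
Proof.
induction n as [|n IH].
- simpl; rewrite sum_O; lra.
- rewrite seq_S, lsum_app, IH, sum_Sn; unfold plus; simpl; lra.
Qed.

(** Bridge from two-sided series to unordered sums, so that theta series can be reindexed without
    rearrangement arguments. A finite set of integers lies in the range from -(N + 1) to N for some
    N. *)
Lemma nsum_BiSeries (f : Z -> R) :
  (forall m, 0 <= f m) -> ex_BiSeries f -> nsum f (BiSeries f).
Proof.
intros Hf [H1 H2].
set (up := fun n => map Z.of_nat (seq 0 (S n))).
set (dn := fun n => map (fun k => (- Z.of_nat (S k))%Z) (seq 0 (S n))).
assert (Eu : forall n, lsum f (up n) = sum_n (fun k => f (Z.of_nat k)) n)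
  by (intros n; unfold up; now rewrite lsum_map, lsum_seq).
assert (Ed : forall n, lsum f (dn n) = sum_n (fun k => f (- Z.of_nat (S k))%Z) n)
  by (intros n; unfold dn; now rewrite lsum_map, lsum_seq).
unfold BiSeries; apply nsum_intro.
- intros L HL.
  assert (HN : exists N, forall z, In z L -> (Z.abs z <= Z.of_nat N)%Z).
  { clear HL; induction L as [|z L [N HN]]; [exists O; easy|].
    exists (N + Z.abs_nat z)%nat; intros y [->|Hy]; [lia|].
    specialize (HN y Hy); lia. }
  destruct HN as [N HN].
  apply Rle_trans with (lsum f (up N ++ dn N)).
  + apply lsum_incl; auto; intros z Hz; specialize (HN z Hz); apply in_or_app.
    destruct (Z_le_gt_dec 0 z).
    * left; apply in_map_iff; exists (Z.to_nat z); split; [lia|apply in_seq; lia].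
    * right; apply in_map_iff; exists (Z.to_nat (- z - 1)); split; [lia|apply in_seq; lia].
  + rewrite lsum_app, Eu, Ed; apply Rplus_le_compat; apply sum_n_le_Series; auto.
- intros c Hc.
  assert (H : forall n m, sum_n (fun k => f (Z.of_nat k)) n
      + sum_n (fun k => f (- Z.of_nat (S k))%Z) m <= c).
  { intros n m; rewrite <- Eu, <- Ed, <- lsum_app; apply Hc, NoDup_app.
    - apply NoDup_map_NoDup_ForallPairs; [intros ? ? ? ?; lia|apply seq_NoDup].
    - apply NoDup_map_NoDup_ForallPairs; [intros ? ? ? ?; lia|apply seq_NoDup].
    - intros z Hz Hz'; unfold up, dn in *; apply in_map_iff in Hz, Hz'.
      destruct Hz as (k & Hk & _); destruct Hz' as (k' & Hk' & _); lia. }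
  enough (Series (fun k => f (Z.of_nat k)) <= c - Series (fun k => f (- Z.of_nat (S k))%Z)) by lra.
  apply Series_le_of_sum_n; [exact H1|]; intros n.
  enough (Series (fun k => f (- Z.of_nat (S k))%Z) <= c - sum_n (fun k => f (Z.of_nat k)) n) by lra.
  apply Series_le_of_sum_n; [exact H2|]; intros m; specialize (H n m); lra.
Qed.

(** * The theta function *)

Definition gauss (s x : R) (m : Z) : R := exp (- (PI * s * (IZR m + x) ^ 2)).

Definition G (s x : R) : R := BiSeries (gauss s x).

Lemma exp_le_compat (x y : R) : x <= y -> exp x <= exp y.
Proof. intros [H | ->]; [left; now apply exp_increasing | right; reflexivity]. Qed.

Lemma exp_opp_INR (n : nat) : exp (- INR n) = exp (-1) ^ n.
Proof.
induction n as [|n IH]; [simpl; now rewrite Ropp_0, exp_0|].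
rewrite S_INR; simpl; rewrite <- IH, <- exp_plus; f_equal; lra.
Qed.

(** Completing the square gives [PI * s * y ^ 2 >= y - / (4 * PI * s)], and y = |m + x| is at least
    |m| - |x|; this yields a geometric majorant. *)
Lemma gauss_le (s x : R) (m : Z) :
  0 < s -> gauss s x m <= exp (Rabs x + / (4 * PI * s)) * exp (-1) ^ Z.abs_nat m.
Proof.
intros Hs; rewrite <- exp_opp_INR, <- exp_plus; apply exp_le_compat.
assert (Hpi := PI_RGT_0); assert (Ha : 0 < PI * s) by nra.
rewrite INR_IZR_INZ, Zabs2Nat.id_abs, abs_IZR.
assert (H1 : Rabs (IZR m) <= Rabs (IZR m + x) + Rabs x).
{ replace (IZR m) with ((IZR m + x) + - x) at 1 by ring.
  eapply Rle_trans; [apply Rabs_triang|]; rewrite Rabs_Ropp; lra. }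
rewrite <- (pow2_abs (IZR m + x)).
set (y := Rabs (IZR m + x)) in *.
assert (H2 : 0 <= PI * s * (y - / (2 * (PI * s))) ^ 2) by (apply Rmult_le_pos; [lra|apply pow2_ge_0]).
replace (PI * s * (y - / (2 * (PI * s))) ^ 2)
  with (PI * s * y ^ 2 - y + / (4 * PI * s)) in H2 by (field; lra).
lra.
Qed.

Lemma ex_BiSeries_gauss (s x : R) : 0 < s -> ex_BiSeries (gauss s x).
Proof.
intros Hs.
assert (Hg : ex_series (fun n : nat => exp (-1) ^ n)).
{ apply ex_series_geom; rewrite Rabs_pos_eq by (apply Rlt_le, exp_pos).
  rewrite <- exp_0; apply exp_increasing; lra. }
assert (H : forall g : nat -> Z, ex_series (fun n => exp (-1) ^ Z.abs_nat (g n)) ->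
  ex_series (fun n => gauss s x (g n))).
{ intros g Hg'.
  apply (ex_series_scal_l (exp (Rabs x + / (4 * PI * s)))) in Hg'.
  eapply @ex_series_le; [|exact Hg'].
  intros n; unfold norm; simpl; unfold abs; simpl.
  rewrite Rabs_pos_eq by (apply Rlt_le, exp_pos); now apply gauss_le. }
split; apply H.
- eapply ex_series_ext; [|exact Hg]; intros n; now rewrite Zabs2Nat.id.
- apply ex_series_incr_1 in Hg; eapply ex_series_ext; [|exact Hg].
  intros n; simpl; f_equal; now rewrite SuccNat2Pos.id_succ.
Qed.

Lemma gauss_pos (s x : R) (m : Z) : 0 < gauss s x m.
Proof. apply exp_pos. Qed.

Lemma nsum_G (s x : R) : 0 < s -> nsum (gauss s x) (G s x).
Proof.
intros Hs; apply nsum_BiSeries; [intros m; apply Rlt_le, gauss_pos|].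
now apply ex_BiSeries_gauss.
Qed.

Lemma G_pos (s x : R) : 0 < s -> 0 < G s x.
Proof.
intros Hs; apply Rlt_le_trans with (lsum (gauss s x) [0%Z]).
- simpl; assert (H := gauss_pos s x 0); lra.
- apply nsum_ub; [now apply nsum_G|]; repeat constructor; easy.
Qed.

Lemma G_shift (s x : R) : 0 < s -> G s (x + 1) = G s x.
Proof.
intros Hs; apply (nsum_unique (gauss s x)); [|now apply nsum_G].
apply (nsum_inj Z.eq_dec (fun m => m + 1)%Z (fun m => m - 1)%Z); try (intros; lia).
apply (nsum_ext (gauss s (x + 1))); [|now apply nsum_G].
intros m; unfold gauss; rewrite plus_IZR; f_equal; ring.
Qed.

Lemma G_opp (s x : R) : 0 < s -> G s (- x) = G s x.
Proof.
intros Hs; apply (nsum_unique (gauss s x)); [|now apply nsum_G].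
apply (nsum_inj Z.eq_dec Z.opp Z.opp); try (intros; lia).
apply (nsum_ext (gauss s (- x))); [|now apply nsum_G].
intros m; unfold gauss; rewrite opp_IZR; f_equal; ring.
Qed.

Lemma Z_pair_dec (a b : Z * Z) : {a = b} + {a <> b}.
Proof. decide equality; apply Z.eq_dec. Qed.

(* The substitutions (m, n) = (i + j, i - j) and (m, n) = (i + j + 1, i - j)
   cover the pairs with m + n even and odd. *)
Lemma G_mul (s x y : R) : 0 < s ->
  G s (x + y) * G s (x - y) =
  G (2 * s) x * G (2 * s) y + G (2 * s) (x + 1 / 2) * G (2 * s) (y + 1 / 2).
Proof.
intros Hs; assert (Hs2 : 0 < 2 * s) by lra.
assert (Hp : forall s x m, 0 <= gauss s x m) by (intros; apply Rlt_le, gauss_pos).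
set (f := fun mn : Z * Z => gauss s (x + y) (fst mn) * gauss s (x - y) (snd mn)).
set (ev := fun mn : Z * Z => Z.even (fst mn + snd mn)).
assert (Hf : forall mn, 0 <= f mn) by (intros; apply Rmult_le_pos; apply Hp).
apply (nsum_unique f); [apply nsum_prod; try apply Z.eq_dec; auto; now apply nsum_G|].
apply (nsum_ext (fun mn => (if ev mn then f mn else 0) + (if ev mn then 0 else f mn)));
  [intros mn; destruct (ev mn); lra|].
apply nsum_plus; [apply Z_pair_dec| | | |];
  try (intros mn; specialize (Hf mn); destruct (ev mn); lra).
- apply (nsum_inj Z_pair_dec (fun ij => (fst ij + snd ij, fst ij - snd ij)%Z)
    (fun mn => ((fst mn + snd mn) / 2, (fst mn - snd mn) / 2)%Z)).
  + intros [i j]; simpl; f_equal; Z.div_mod_to_equations; lia.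
  + intros [m n]; unfold ev; simpl; intros H.
    destruct (Z.even (m + n)) eqn:E; [|reflexivity].
    exfalso; apply H; apply Z.even_spec in E; destruct E as [k E].
    f_equal; Z.div_mod_to_equations; lia.
  + eapply nsum_ext; [|apply (nsum_prod Z.eq_dec Z.eq_dec (gauss (2 * s) x) (gauss (2 * s) y));
      auto; now apply nsum_G].
    intros [i j]; unfold ev, f, gauss; simpl.
    replace (Z.even (i + j + (i - j))) with true
      by (symmetry; apply Z.even_spec; exists i; lia).
    rewrite <- !exp_plus, plus_IZR, minus_IZR; f_equal; ring.
- apply (nsum_inj Z_pair_dec (fun ij => (fst ij + snd ij + 1, fst ij - snd ij)%Z)
    (fun mn => ((fst mn + snd mn) / 2, (fst mn - snd mn) / 2)%Z)).
  + intros [i j]; simpl; f_equal; Z.div_mod_to_equations; lia.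
  + intros [m n]; unfold ev; simpl; intros H.
    destruct (Z.even (m + n)) eqn:E; [reflexivity|].
    exfalso; apply H; rewrite <- Z.negb_odd in E; apply Bool.negb_false_iff, Z.odd_spec in E.
    destruct E as [k E]; f_equal; Z.div_mod_to_equations; lia.
  + eapply nsum_ext; [|apply (nsum_prod Z.eq_dec Z.eq_dec
      (gauss (2 * s) (x + 1 / 2)) (gauss (2 * s) (y + 1 / 2))); auto; now apply nsum_G].
    intros [i j]; unfold ev, f, gauss; simpl.
    replace (Z.even (i + j + 1 + (i - j))) with false
      by (symmetry; rewrite <- Z.negb_odd; apply Bool.negb_false_iff, Z.odd_spec; exists i; lia).
    rewrite <- !exp_plus, !plus_IZR, minus_IZR; f_equal; field.
Qed.

(** For m = n k + r one has s m^2 = s n^2 (k + r/n)^2, so each residue class contributes one theta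
    value. The classes are added one at a time by induction. *)
Lemma G_residues (s : R) (n : nat) : 0 < s -> (0 < n)%nat ->
  G s 0 = lsum (fun r => G (s * INR n ^ 2) (INR r / INR n)) (seq 0 n).
Proof.
intros Hs Hn; assert (Hn' : 0 < INR n) by now apply lt_0_INR.
assert (Hs2 : 0 < s * INR n ^ 2) by (apply Rmult_lt_0_compat, pow_lt; assumption).
assert (Hp : forall s x m, 0 <= gauss s x m) by (intros; apply Rlt_le, gauss_pos).
set (res := fun m => Z.to_nat (m mod Z.of_nat n)).
assert (H : forall k, (k <= n)%nat ->
  nsum (fun m => if (res m <? k)%nat then gauss s 0 m else 0)
    (lsum (fun r => G (s * INR n ^ 2) (INR r / INR n)) (seq 0 k))).
{ induction k as [|k IH]; intros Hk.
  { apply nsum_intro.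
    - intros L _; apply Req_le.
      rewrite (lsum_ext_in _ (fun _ => 0 * 0)) by (intros; simpl; lra).
      rewrite lsum_scal; simpl; lra.
    - intros b Hb; exact (Hb nil (NoDup_nil _)). }
  rewrite seq_S, lsum_app; simpl lsum; rewrite Rplus_0_r.
  apply (nsum_ext (fun m => (if (res m <? k)%nat then gauss s 0 m else 0)
    + (if (res m =? k)%nat then gauss s 0 m else 0))).
  { intros m; destruct (Nat.ltb_spec (res m) k), (Nat.eqb_spec (res m) k),
      (Nat.ltb_spec (res m) (S k)); try lia; lra. }
  apply nsum_plus; [apply Z.eq_dec| | |apply IH; lia|].
  - intros m; specialize (Hp s 0 m); destruct (_ <? _)%nat; lra.
  - intros m; specialize (Hp s 0 m); destruct (_ =? _)%nat; lra.
  - apply (nsum_inj Z.eq_dec (fun m => Z.of_nat n * m + Z.of_nat k)%Z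
      (fun m => (m / Z.of_nat n)%Z)).
    + intros m; symmetry; apply (Z.div_unique _ _ _ (Z.of_nat k)); lia.
    + intros m Hm; destruct (Nat.eqb_spec (res m) k) as [E|]; [|reflexivity].
      exfalso; apply Hm; unfold res in E; subst k.
      assert (E1 := Z.div_mod m (Z.of_nat n)).
      assert (E2 := Z.mod_pos_bound m (Z.of_nat n)); lia.
    + eapply nsum_ext; [|now apply nsum_G]; intros m; cbv beta.
      replace (res (Z.of_nat n * m + Z.of_nat k)%Z) with k; cycle 1.
      { unfold res; rewrite <- (Z.mod_unique (Z.of_nat n * m + Z.of_nat k)
          (Z.of_nat n) m (Z.of_nat k)); lia. }
      rewrite Nat.eqb_refl; unfold gauss.
      rewrite plus_IZR, mult_IZR, <- !INR_IZR_INZ; f_equal; field; lra. }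
apply (nsum_unique (gauss s 0)); [now apply nsum_G|].
eapply nsum_ext; [|apply (H n (le_n n))]; intros m; cbv beta.
destruct (Nat.ltb_spec (res m) n) as [_|E]; [reflexivity|exfalso].
assert (E2 := Z.mod_pos_bound m (Z.of_nat n)); unfold res in E; lia.
Qed.

Lemma phi_exp (s : R) : phi (exp (- (s * PI))) = G s 0.
Proof.
assert (H : forall m : Z, powerRZ (exp (- (s * PI))) (m ^ 2) = gauss s 0 m).
{ intros m; rewrite powerRZ_Rpower by apply exp_pos; unfold Rpower, gauss.
  rewrite ln_exp, Z.pow_2_r, mult_IZR; f_equal; ring. }
unfold phi, G, BiSeries; f_equal; apply Series_ext; intros n; apply H.
Qed.

(** * The Gaussian integral *)

(** The factor [PI] normalizes the integral over the half line to 1/2, as [gint_le] and [gint_ge]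
    show. *)
Definition gint (x : R) : R := RInt (fun t => exp (- (PI * t ^ 2))) 0 x.

Lemma continuous_gaussian (t : R) : continuous (fun t => exp (- (PI * t ^ 2))) t.
Proof. apply (ex_derive_continuous (fun t => exp (- (PI * t ^ 2)))); auto_derive; exact I. Qed.

Lemma ex_RInt_gaussian (a b : R) : ex_RInt (fun t => exp (- (PI * t ^ 2))) a b.
Proof. apply (@ex_RInt_continuous R_CompleteNormedModule); intros; apply continuous_gaussian. Qed.

(* [gint x ^ 2 + RInt (gaux x) 0 1] does not depend on [x]. *)
Definition gaux (x t : R) : R := exp (- (PI * x ^ 2 * (1 + t ^ 2))) / (PI * (1 + t ^ 2)).

Lemma one_plus_sq_pos (t : R) : 0 < 1 + t ^ 2.
Proof. assert (H := pow2_ge_0 t); lra. Qed.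

Lemma is_derive_gaux (x t : R) :
  is_derive (fun u => gaux u t) x (- (2 * x * exp (- (PI * x ^ 2 * (1 + t ^ 2))))).
Proof.
assert (H := PI_RGT_0); assert (H1 := one_plus_sq_pos t).
unfold gaux; auto_derive; [nra|].
replace (PI * (x * (x * 1)) * (1 + t * (t * 1))) with (PI * x ^ 2 * (1 + t ^ 2)) by ring.
field; split; simpl in *; lra.
Qed.

Lemma continuous_gaux (x t : R) : continuous (gaux x) t.
Proof.
assert (H := PI_RGT_0); assert (H1 := one_plus_sq_pos t); simpl in H1.
apply (ex_derive_continuous (gaux x)); unfold gaux; auto_derive; nra.
Qed.

Lemma ex_RInt_gaux (x a b : R) : ex_RInt (gaux x) a b.
Proof. apply (@ex_RInt_continuous R_CompleteNormedModule); intros; apply continuous_gaux. Qed.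

Lemma is_derive_gint (x : R) : is_derive gint x (exp (- (PI * x ^ 2))).
Proof.
apply (is_derive_RInt (fun t => exp (- (PI * t ^ 2))) gint 0).
- apply filter_forall; intros y; apply (@RInt_correct R_CompleteNormedModule), ex_RInt_gaussian.
- apply continuous_gaussian.
Qed.

(** Differentiation under the integral sign; the substitution u = x t then produces [gint x], so
    that this derivative cancels that of [gint x ^ 2]. *)
Lemma is_derive_RInt_gaux (x : R) :
  is_derive (fun x => RInt (gaux x) 0 1) x (- (2 * exp (- (PI * x ^ 2)) * gint x)).
Proof.
assert (HD : forall u t, Derive (fun z => gaux z t) u = - (2 * u * exp (- (PI * u ^ 2 * (1 + t ^ 2)))))
  by (intros; apply is_derive_unique, is_derive_gaux).
evar_last.
{ apply (is_derive_RInt_param gaux 0 1 x).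
  - apply filter_forall; intros y t _; eexists; apply is_derive_gaux.
  - intros t _; apply (continuity_2d_pt_ext (fun u v => - (2 * u) * exp (- (PI * u ^ 2 * (1 + v ^ 2))))).
    { intros u v; rewrite HD; ring. }
    apply continuity_2d_pt_mult.
    + apply (continuity_1d_2d_pt_comp (fun u => - (2 * u)) (fun u v => u)).
      * apply derivable_continuous_pt; reg.
      * apply continuity_2d_pt_id1.
    + apply (continuity_1d_2d_pt_comp exp (fun u v => - (PI * u ^ 2 * (1 + v ^ 2)))).
      * apply derivable_continuous_pt; reg.
      * apply continuity_2d_pt_opp, continuity_2d_pt_mult.
        -- apply (continuity_1d_2d_pt_comp (fun u => PI * u ^ 2) (fun u v => u)).
           ++ apply derivable_continuous_pt; reg.
           ++ apply continuity_2d_pt_id1.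
        -- apply (continuity_1d_2d_pt_comp (fun u => 1 + u ^ 2) (fun u v => v)).
           ++ apply derivable_continuous_pt; reg.
           ++ apply continuity_2d_pt_id2.
  - apply filter_forall; intros y; apply ex_RInt_gaux. }
simpl.
rewrite (RInt_ext _ (fun t => - (2 * exp (- (PI * x ^ 2))) * (x * exp (- (PI * (x * t + 0) ^ 2))))).
2:{ intros t _; rewrite HD.
    replace (- (PI * x ^ 2 * (1 + t ^ 2))) with (- (PI * x ^ 2) + - (PI * (x * t + 0) ^ 2)) by ring.
    rewrite exp_plus; match goal with |- ?a = ?b => change (a = b :> R) end; ring. }
assert (He : ex_RInt (fun t => x * exp (- (PI * (x * t + 0) ^ 2))) 0 1).
{ apply (ex_RInt_comp_lin (fun t => exp (- (PI * t ^ 2))) x 0 0 1), ex_RInt_gaussian. }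
rewrite (RInt_scal (fun t => x * exp (- (PI * (x * t + 0) ^ 2)))) by exact He.
assert (E : RInt (fun t => x * exp (- (PI * (x * t + 0) ^ 2))) 0 1 = gint x).
{ etransitivity; [apply (RInt_comp_lin (fun t => exp (- (PI * t ^ 2))) x 0 0 1), ex_RInt_gaussian|].
  unfold gint; f_equal; ring. }
rewrite E; unfold scal; simpl; unfold mult; simpl.
match goal with |- ?a = ?b => change (a = b :> R) end; ring.
Qed.

(** The left side has derivative zero, and at x = 0 it is the integral of 1/(PI (1 + t^2)) over
    [0, 1], that is atan(1)/PI = 1/4. *)
Lemma gint_sqr (x : R) : 0 <= x -> gint x ^ 2 + RInt (gaux x) 0 1 = 1 / 4.
Proof.
intros Hx.
assert (H : forall y, is_derive (fun x => gint x ^ 2 + RInt (gaux x) 0 1) y 0).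
{ intros y; evar_last.
  - apply (is_derive_plus (fun x => gint x ^ 2)).
    + apply (is_derive_pow gint 2), is_derive_gint.
    + apply is_derive_RInt_gaux.
  - unfold plus; simpl; ring. }
assert (E : RInt (gaux 0) 0 1 = 1 / 4).
{ apply is_RInt_unique; evar_last.
  - apply (is_RInt_derive (fun t => / PI * atan t) (gaux 0)).
    + intros t _; unfold gaux; assert (H0 := PI_RGT_0); assert (H1 := one_plus_sq_pos t).
      evar_last; [apply (is_derive_scal atan t (/ PI)), is_derive_atan|].
      simpl; match goal with |- ?a = ?b => change (a = b :> R) end.
      replace (PI * (0 * (0 * 1)) * (1 + t * (t * 1))) with 0 by ring.
      rewrite Ropp_0, exp_0; unfold Rsqr; field; simpl in H1; split; lra.
    + intros t _; apply continuous_gaux.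
  - unfold minus, plus, opp; simpl; rewrite atan_0, atan_1; field; apply PI_neq0. }
assert (E0 : gint 0 = 0) by apply (@RInt_point R_CompleteNormedModule).
rewrite <- E.
destruct (MVT_gen (fun x => gint x ^ 2 + RInt (gaux x) 0 1) 0 x (fun _ => 0)) as (c & _ & Hc).
- intros; apply H.
- intros y _; apply derivable_continuous_pt; exists 0; apply is_derive_Reals, H.
- rewrite E0 in Hc; lra.
Qed.

Lemma RInt_gaux_bounds (x : R) : 0 <= RInt (gaux x) 0 1 <= exp (- (PI * x ^ 2)).
Proof.
assert (H0 := PI_RGT_0); assert (H3 := PI_4).
assert (Hpi : 1 <= PI) by (assert (H := PI2_1); lra).
split.
- apply RInt_ge_0; [lra|apply ex_RInt_gaux|].
  intros t _; apply Rlt_le, Rdiv_lt_0_compat; [apply exp_pos|].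
  apply Rmult_lt_0_compat; [lra|apply one_plus_sq_pos].
- replace (exp (- (PI * x ^ 2))) with (RInt (fun _ => exp (- (PI * x ^ 2))) 0 1)
    by (rewrite RInt_const; unfold scal; simpl; unfold mult; simpl; ring).
  apply RInt_le; [lra|apply ex_RInt_gaux|apply ex_RInt_const|].
  intros t _; unfold gaux; assert (Ht := pow2_ge_0 t); assert (Hx := pow2_ge_0 x).
  assert (Htx := Rmult_le_pos _ _ (Rmult_le_pos PI _ ltac:(lra) Hx) Ht).
  assert (Hpt := Rmult_le_pos PI _ ltac:(lra) Ht).
  apply Rle_div_l; [lra|].
  apply Rle_trans with (exp (- (PI * x ^ 2)) * 1).
  + rewrite Rmult_1_r; apply exp_le_compat; lra.
  + apply Rmult_le_compat_l; [apply Rlt_le, exp_pos|lra].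
Qed.

Lemma gint_ge0 (x : R) : 0 <= x -> 0 <= gint x.
Proof.
intros Hx; apply RInt_ge_0; [exact Hx|apply ex_RInt_gaussian|].
intros; apply Rlt_le, exp_pos.
Qed.

Lemma gint_le (x : R) : 0 <= x -> gint x <= 1 / 2.
Proof.
intros Hx; assert (H := gint_sqr x Hx); assert (H1 := RInt_gaux_bounds x).
assert (H2 := gint_ge0 x Hx); nra.
Qed.

(** For g = [gint x], the product (1/2 - g)(1/2 + g) = 1/4 - g^2 is at most exp(-PI x^2), and
    exp(-y) <= 1/y. The rate is crude; only the limit 1/2 matters. *)
Lemma gint_ge (x : R) : 0 < x -> 1 / 2 - 2 / (PI * x ^ 2) <= gint x.
Proof.
intros Hx; assert (H := gint_sqr x ltac:(lra)); assert (H1 := RInt_gaux_bounds x).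
assert (H2 := gint_ge0 x ltac:(lra)); assert (H3 := gint_le x ltac:(lra)).
assert (Hy : 0 < PI * x ^ 2) by (apply Rmult_lt_0_compat; [apply PI_RGT_0|apply pow_lt; lra]).
assert (H4 : exp (- (PI * x ^ 2)) <= 1 / (PI * x ^ 2)).
{ rewrite exp_Ropp; apply Rle_div_r; [exact Hy|].
  rewrite Rmult_comm; apply Rle_div_l; [apply exp_pos|].
  assert (H5 := exp_ineq1_le (PI * x ^ 2)); lra. }
replace (2 / (PI * x ^ 2)) with (2 * (1 / (PI * x ^ 2))) by (field; split; [lra|apply PI_neq0]).
nra.
Qed.

Lemma gaussian_step (h : R) (m : nat) : 0 < h ->
  h * exp (- (PI * (h * INR (S m)) ^ 2)) <= gint (h * INR (S m)) - gint (h * INR m)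
    <= h * exp (- (PI * (h * INR m) ^ 2)).
Proof.
intros Hh; assert (Hm := pos_INR m); assert (Hpi := PI_RGT_0).
assert (E : gint (h * INR (S m)) - gint (h * INR m) =
  RInt (fun t => exp (- (PI * t ^ 2))) (h * INR m) (h * INR (S m))).
{ unfold gint; rewrite <- (RInt_Chasles _ 0 (h * INR m) (h * INR (S m)))
    by apply ex_RInt_gaussian; unfold plus; simpl; ring. }
rewrite E; rewrite S_INR in *.
assert (Ec : forall c, RInt (fun _ => c) (h * INR m) (h * (INR m + 1)) = h * c)
  by (intros c; rewrite RInt_const; unfold scal; simpl; unfold mult; simpl; ring).
split; [rewrite <- (Ec (exp (- (PI * (h * (INR m + 1)) ^ 2))))
  |rewrite <- (Ec (exp (- (PI * (h * INR m) ^ 2))))];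
  (apply RInt_le; [nra| | |]); try apply ex_RInt_gaussian; try apply ex_RInt_const; intros t Ht; apply exp_le_compat, Ropp_le_contravar,
  Rmult_le_compat_l; try lra; apply pow_incr; nra.
Qed.

Lemma gaussian_sum_bounds (h : R) (n : nat) : 0 < h ->
  h * sum_n (fun m => exp (- (PI * (h * INR (S m)) ^ 2))) n <= gint (h * INR (S n))
    <= h * sum_n (fun m => exp (- (PI * (h * INR m) ^ 2))) n.
Proof.
intros Hh; induction n as [|n IH].
- rewrite !sum_O; assert (H := gaussian_step h 0 Hh).
  replace (gint (h * INR 0)) with 0 in H; [lra|].
  simpl; rewrite Rmult_0_r; symmetry; apply (@RInt_point R_CompleteNormedModule).
- rewrite !sum_Sn; change (@plus _) with Rplus.
  assert (H := gaussian_step h (S n) Hh); lra.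
Qed.

(** With h = [sqrt s], h times the one-sided sum is a Riemann sum of the Gaussian: a lower one
    without the term at 0, an upper one with it. [G s 0] is twice the former sum plus 1 and twice
    the latter minus 1. *)
Lemma G_bounds (s : R) : 0 < s -> 1 / sqrt s - 1 <= G s 0 <= 1 / sqrt s + 1.
Proof.
intros Hs; set (h := sqrt s); assert (Hh : 0 < h) by now apply sqrt_lt_R0.
assert (Hpi := PI_RGT_0).
assert (Eg : forall m, gauss s 0 m = exp (- (PI * (h * IZR m) ^ 2))).
{ intros m; unfold gauss; f_equal; rewrite <- (sqrt_sqrt s) by lra; fold h; ring. }
set (a := fun n : nat => exp (- (PI * (h * INR n) ^ 2))).
assert (Ha : forall n, 0 <= a n) by (intros; apply Rlt_le, exp_pos).
destruct (ex_BiSeries_gauss s 0 Hs) as [H1 _].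
assert (E1 : forall n, gauss s 0 (Z.of_nat n) = a n)
  by (intros n; rewrite Eg; unfold a; now rewrite INR_IZR_INZ).
apply (ex_series_ext _ a E1) in H1.
assert (H2 := proj1 (ex_series_incr_1 a) H1).
assert (EG : G s 0 = Series a + Series (fun n => a (S n))).
{ unfold G, BiSeries; f_equal; apply Series_ext; intros n; [apply E1|].
  rewrite <- E1; unfold gauss; rewrite opp_IZR; f_equal; ring. }
assert (E0 : Series a = 1 + Series (fun n => a (S n))).
{ rewrite (Series_incr_1 a H1); f_equal; unfold a; simpl.
  rewrite <- exp_0; f_equal; ring. }
assert (HU : Series (fun n => a (S n)) <= 1 / 2 * / h).
{ apply Series_le_of_sum_n; [exact H2|]; intros n; apply Rle_div_r; [exact Hh|].
  rewrite Rmult_comm; eapply Rle_trans; [apply (gaussian_sum_bounds h n Hh)|].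
  apply gint_le; apply Rmult_le_pos; [lra|apply pos_INR]. }
assert (HL : 1 / 2 <= h * Series a).
{ apply (is_lim_seq_le (fun n => 1 / 2 - 2 / (PI * (h * INR (S n)) ^ 2)) (fun _ => h * Series a)
    (Finite (1 / 2)) (Finite (h * Series a))).
  - intros n; eapply Rle_trans; [apply gint_ge|].
    + apply Rmult_lt_0_compat; [exact Hh|apply lt_0_INR; lia].
    + eapply Rle_trans; [apply (gaussian_sum_bounds h n Hh)|].
      apply Rmult_le_compat_l; [lra|]; now apply (sum_n_le_Series a).
  - replace (Finite (1 / 2)) with (Rbar_minus (1 / 2) 0) by (simpl; f_equal; lra).
    apply is_lim_seq_minus'; [apply is_lim_seq_const|].
    apply (is_lim_seq_le_le (fun _ => 0) _ (fun n => 2 / (PI * h ^ 2) * / INR (S n))).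
    + intros n; assert (Hn : 1 <= INR (S n)) by (rewrite S_INR; assert (H := pos_INR n); lra).
      assert (Hd : 0 < PI * h ^ 2) by (apply Rmult_lt_0_compat, pow_lt; lra).
      split.
      * apply Rlt_le, Rdiv_lt_0_compat; [lra|].
        rewrite Rpow_mult_distr, <- Rmult_assoc; apply Rmult_lt_0_compat, pow_lt; lra.
      * rewrite Rpow_mult_distr, <- Rmult_assoc.
        unfold Rdiv; rewrite Rinv_mult, <- Rmult_assoc.
        apply Rmult_le_compat_l; [apply Rlt_le, Rdiv_lt_0_compat; lra|].
        apply Rinv_le_contravar; nra.
    + apply is_lim_seq_const.
    + replace (Finite 0) with (Rbar_mult (2 / (PI * h ^ 2)) 0) by (simpl; f_equal; ring).
      apply is_lim_seq_scal_l.
      apply (is_lim_seq_incr_1 (fun n => / INR n)).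
      apply (is_lim_seq_inv INR p_infty); [apply is_lim_seq_INR|discriminate].
  - apply is_lim_seq_const. }
assert (HL' : 1 / 2 * / h <= Series a).
{ apply Rle_div_l; [exact Hh|lra]. }
rewrite EG; unfold Rdiv in *; lra.
Qed.

(** * The arithmetic-geometric mean and theta inversion *)

(** The step acts on the starting pair before the recursive call, so one step of the mean is a shift
    of the index in [is_agm]. *)
Fixpoint agm (n : nat) (a b : R) : R * R :=
  match n with
  | O => (a, b)
  | S n => agm n ((a + b) / 2) (sqrt (a * b))
  end.

Definition is_agm (a b M : R) : Prop := is_lim_seq (fun n => fst (agm n a b)) M.

Lemma agm_scal (c a b : R) (n : nat) : 0 <= c -> 0 <= a -> 0 <= b ->
  agm n (c * a) (c * b) = (c * fst (agm n a b), c * snd (agm n a b)).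
Proof.
intros Hc; revert a b; induction n as [|n IH]; intros a b Ha Hb; [reflexivity|].
cbn [agm].
replace ((c * a + c * b) / 2) with (c * ((a + b) / 2)) by field.
replace (c * a * (c * b)) with ((c * c) * (a * b)) by ring.
rewrite sqrt_mult, sqrt_square by nra; apply IH; [lra|apply sqrt_pos].
Qed.

Lemma agm_le (a b a' b' : R) (n : nat) : 0 <= a <= a' -> 0 <= b <= b' ->
  fst (agm n a b) <= fst (agm n a' b').
Proof.
revert a b a' b'; induction n as [|n IH]; intros a b a' b' Ha Hb; [easy|].
cbn [agm]; apply IH; [lra|].
split; [apply sqrt_pos|apply sqrt_le_1_alt]; apply Rmult_le_compat; lra.
Qed.

Lemma is_agm_scal (c a b M : R) : 0 <= c -> 0 <= a -> 0 <= b ->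
  is_agm a b M -> is_agm (c * a) (c * b) (c * M).
Proof.
intros Hc Ha Hb H; apply (is_lim_seq_ext (fun n => c * fst (agm n a b))).
- intros n; now rewrite agm_scal.
- now apply (is_lim_seq_scal_l _ c (Finite M)).
Qed.

Lemma is_agm_step (a b M : R) : is_agm a b M -> is_agm ((a + b) / 2) (sqrt (a * b)) M.
Proof. intros H; apply is_lim_seq_incr_1 in H; exact H. Qed.

(* After one step both components have grown by a common factor [l > 1]. *)
Lemma is_agm_lt (b b' M M' : R) : 0 <= b < b' -> 0 < M ->
  is_agm 1 b M -> is_agm 1 b' M' -> M < M'.
Proof.
intros Hb HM H H'.
(* [m] is the ratio of the arithmetic means and also m b <= b', so both means grow at least by the
   factor [l], the square root of [m]. *)
set (m := (1 + b') / (1 + b)); set (l := sqrt m).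
assert (Hm : 1 < m) by (unfold m; apply Rlt_div_r; lra).
assert (Hl : 1 < l) by (rewrite <- sqrt_1; apply sqrt_lt_1_alt; lra).
assert (Hlm : l <= m) by (rewrite <- (sqrt_sqrt m) by lra; fold l; nra).
assert (Em : m * (1 + b) = 1 + b') by (unfold m; field; lra).
assert (Hmb : m * b <= b') by nra.
enough (l * M <= M') by nra.
apply is_agm_step in H, H'; rewrite Rmult_1_l in H, H'.
apply (is_agm_scal l) in H; [|lra|lra|apply sqrt_pos].
refine (is_lim_seq_le _ _ (Finite (l * M)) (Finite M') _ H H').
intros n; apply agm_le; split.
- apply Rmult_le_pos; lra.
- nra.
- apply Rmult_le_pos; [lra|apply sqrt_pos].
- unfold l; rewrite <- sqrt_mult by lra; apply sqrt_le_1_alt; lra.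
Qed.

(* The squares of the theta constants theta_3, theta_2, theta_4 at [tau = i s]. *)
Definition G0sq (s : R) : R := G s 0 ^ 2.
Definition Ghsq (s : R) : R := G s (1 / 2) ^ 2.
Definition Gcsq (s : R) : R := sqrt (G0sq s ^ 2 - Ghsq s ^ 2).

Lemma G_shift_half (s : R) : 0 < s -> G s (1 / 2 + 1 / 2) = G s 0.
Proof.
intros Hs; replace (1 / 2 + 1 / 2) with (0 + 1) by lra; now apply G_shift.
Qed.

(** [G_mul] at x = y = 0; the next lemma is the case x = 1/2, y = 0. Together they make the pair
    ([G0sq], [Ghsq]) at s twice the mean step of the pair at 2 s. *)
Lemma G0sq_double (s : R) : 0 < s -> G0sq s = G0sq (2 * s) + Ghsq (2 * s).
Proof.
intros Hs; assert (H := G_mul s 0 0 Hs).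
rewrite Rplus_0_r, Rminus_0_r, Rplus_0_l in H; unfold G0sq, Ghsq; lra.
Qed.

Lemma Ghsq_double (s : R) : 0 < s -> Ghsq s = 2 * (G (2 * s) 0 * G (2 * s) (1 / 2)).
Proof.
intros Hs; assert (H := G_mul s (1 / 2) 0 Hs).
rewrite Rplus_0_r, Rminus_0_r, Rplus_0_l, G_shift_half in H by lra; unfold Ghsq; lra.
Qed.

Lemma Ghsq_le_G0sq (s : R) : 0 < s -> Ghsq s <= G0sq s.
Proof.
intros Hs; rewrite G0sq_double, Ghsq_double by exact Hs; unfold G0sq, Ghsq.
assert (H := pow2_ge_0 (G (2 * s) 0 - G (2 * s) (1 / 2))); lra.
Qed.

(** (a + b)^2 - 4 a b = (a - b)^2. With [G0sq_double], the arithmetic mean of [G0sq s] and [Gcsq s]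
    is [G0sq (2 * s)]. *)
Lemma Gcsq_double (s : R) : 0 < s -> Gcsq s = G0sq (2 * s) - Ghsq (2 * s).
Proof.
intros Hs; unfold Gcsq; rewrite <- (sqrt_pow2 (G0sq (2 * s) - Ghsq (2 * s))).
- f_equal; rewrite G0sq_double, (Ghsq_double s) by exact Hs; unfold G0sq, Ghsq; ring.
- assert (H := Ghsq_le_G0sq (2 * s)); lra.
Qed.

Lemma G0sq_pos (s : R) : 0 < s -> 0 < G0sq s.
Proof. intros Hs; apply pow_lt; now apply G_pos. Qed.

Lemma Ghsq_pos (s : R) : 0 < s -> 0 < Ghsq s.
Proof. intros Hs; apply pow_lt; now apply G_pos. Qed.

Lemma Gcsq_ge0 (s : R) : 0 <= Gcsq s.
Proof. apply sqrt_pos. Qed.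

Lemma Gcsq_sqr (s : R) : 0 < s -> Gcsq s ^ 2 + Ghsq s ^ 2 = G0sq s ^ 2.
Proof.
intros Hs; unfold Gcsq; rewrite pow2_sqrt; [ring|].
assert (H := Ghsq_le_G0sq s Hs); assert (H1 := Ghsq_pos s Hs); nra.
Qed.

Lemma agm_up (n : nat) (s : R) : 0 < s ->
  fst (agm n (G0sq s) (Gcsq s)) = G0sq (2 ^ n * s).
Proof.
revert s; induction n as [|n IH]; intros s Hs; [simpl; f_equal; lra|].
cbn [agm].
replace ((G0sq s + Gcsq s) / 2) with (G0sq (2 * s))
  by (rewrite Gcsq_double, (G0sq_double s) by exact Hs; lra).
replace (sqrt (G0sq s * Gcsq s)) with (Gcsq (2 * s)).
- rewrite IH by lra; f_equal; simpl; ring.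
- rewrite (Gcsq_double s), (G0sq_double s) by exact Hs; unfold Gcsq; f_equal; ring.
Qed.

Lemma agm_down (n : nat) (s : R) : 0 < s ->
  fst (agm n (G0sq s) (Ghsq s)) = / 2 ^ n * G0sq (/ 2 ^ n * s).
Proof.
revert s; induction n as [|n IH]; intros s Hs; [simpl; rewrite Rinv_1, !Rmult_1_l; reflexivity|].
assert (Hs2 : 0 < s / 2) by lra.
assert (E : 2 * (s / 2) = s) by field.
cbn [agm].
replace ((G0sq s + Ghsq s) / 2) with (/ 2 * G0sq (s / 2))
  by (rewrite (G0sq_double (s / 2)), E by exact Hs2; lra).
replace (sqrt (G0sq s * Ghsq s)) with (/ 2 * Ghsq (s / 2)).
- rewrite agm_scal; [|lra|now apply Rlt_le, G0sq_pos|now apply Rlt_le, Ghsq_pos].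
  assert (H2 : 0 < 2 ^ n) by (apply pow_lt; lra).
  cbn [fst]; rewrite IH by exact Hs2; simpl; rewrite Rinv_mult, <- Rmult_assoc.
  f_equal; f_equal; field; lra.
- rewrite (Ghsq_double (s / 2)), E by exact Hs2; unfold G0sq, Ghsq.
  assert (H0 := G_pos s 0 Hs); assert (H1 := G_pos s (1 / 2) Hs).
  rewrite <- Rpow_mult_distr, sqrt_pow2 by (apply Rmult_le_pos; lra); field.
Qed.

Lemma is_lim_seq_sqrt_half_pow (c : R) : 0 < c ->
  is_lim_seq (fun n => sqrt (/ 2 ^ n * c)) 0.
Proof.
intros Hc; rewrite <- sqrt_0.
apply (is_lim_seq_continuous sqrt); [apply continuity_pt_sqrt; lra|].
replace (Finite 0) with (Rbar_mult 0 c) by (simpl; f_equal; ring).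
apply is_lim_seq_scal_r.
apply (is_lim_seq_ext (fun n => (/ 2) ^ n)); [intros n; now rewrite pow_inv|].
apply is_lim_seq_geom; rewrite Rabs_pos_eq; lra.
Qed.

(** As s grows, all terms of [G s 0] but the one at m = 0 die out: that term is 1 and gives the
    lower bound, [G_bounds] gives the upper one. *)
Lemma is_agm_G0sq_Gcsq (s : R) : 0 < s -> is_agm (G0sq s) (Gcsq s) 1.
Proof.
intros Hs.
apply (is_lim_seq_ext (fun n => G (2 ^ n * s) 0 * G (2 ^ n * s) 0)).
{ intros n; rewrite agm_up by exact Hs; unfold G0sq; ring. }
assert (H : is_lim_seq (fun n => G (2 ^ n * s) 0) 1).
{ apply (is_lim_seq_le_le (fun _ => 1) _ (fun n => sqrt (/ 2 ^ n * / s) + 1)).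
  - intros n; assert (H2 : 0 < 2 ^ n) by (apply pow_lt; lra).
    assert (Hsn : 0 < 2 ^ n * s) by (apply Rmult_lt_0_compat; lra).
    split.
    + apply Rle_trans with (lsum (gauss (2 ^ n * s) 0) [0%Z]).
      * assert (E : gauss (2 ^ n * s) 0 0 = 1)
          by (unfold gauss; rewrite <- exp_0; f_equal; ring).
        cbn [lsum fold_right]; lra.
      * apply nsum_ub; [now apply nsum_G|]; repeat constructor; easy.
    + eapply Rle_trans; [apply (G_bounds _ Hsn)|]; apply Req_le; f_equal.
      rewrite <- Rinv_mult, sqrt_inv; field; apply Rgt_not_eq, sqrt_lt_R0, Hsn.
  - apply is_lim_seq_const.
  - replace (Finite 1) with (Rbar_plus 0 1) by (simpl; f_equal; ring).
    apply is_lim_seq_plus'; [apply is_lim_seq_sqrt_half_pow, Rinv_0_lt_compat, Hs|].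
    apply is_lim_seq_const. }
replace (Finite 1) with (Rbar_mult 1 1) by (simpl; f_equal; ring).
now apply is_lim_seq_mult'.
Qed.

(** Here s / 2^n tends to 0, and [G_bounds] makes sqrt(s) G(s, 0) tend to 1 as s tends to 0; this is
    where the exact value of the Gaussian integral matters. *)
Lemma is_agm_G0sq_Ghsq (s : R) : 0 < s -> is_agm (G0sq s) (Ghsq s) (/ s).
Proof.
intros Hs.
set (r := fun n => sqrt (/ 2 ^ n * s)).
assert (Hsn : forall n, 0 < / 2 ^ n * s)
  by (intros n; apply Rmult_lt_0_compat; [apply Rinv_0_lt_compat, pow_lt|]; lra).
assert (Hr : forall n, 0 < r n) by (intros n; apply sqrt_lt_R0, Hsn).
apply (is_lim_seq_ext (fun n => / s * ((r n * G (/ 2 ^ n * s) 0) * (r n * G (/ 2 ^ n * s) 0)))).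
{ intros n; rewrite agm_down by exact Hs; unfold G0sq.
  replace (r n * G (/ 2 ^ n * s) 0 * (r n * G (/ 2 ^ n * s) 0))
    with ((r n * r n) * G (/ 2 ^ n * s) 0 ^ 2) by ring.
  unfold r; rewrite sqrt_sqrt by (apply Rlt_le, Hsn); field; split; [|lra].
  apply pow_nonzero; lra. }
assert (H : is_lim_seq (fun n => r n * G (/ 2 ^ n * s) 0) 1).
{ assert (Hr0 := is_lim_seq_sqrt_half_pow s Hs); fold r in Hr0.
  apply (is_lim_seq_le_le (fun n => 1 - r n) _ (fun n => 1 + r n)).
  - intros n; destruct (G_bounds _ (Hsn n)) as [H1 H2]; specialize (Hr n).
    apply (Rmult_le_compat_l (r n)) in H1, H2; try lra.
    replace (r n * (1 / sqrt (/ 2 ^ n * s) - 1)) with (1 - r n) in H1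
      by (unfold r; field; apply Rgt_not_eq, Hr).
    replace (r n * (1 / sqrt (/ 2 ^ n * s) + 1)) with (1 + r n) in H2
      by (unfold r; field; apply Rgt_not_eq, Hr).
    lra.
  - replace (Finite 1) with (Rbar_minus 1 0) by (simpl; f_equal; ring).
    apply is_lim_seq_minus'; [apply is_lim_seq_const|exact Hr0].
  - replace (Finite 1) with (Rbar_plus 1 0) by (simpl; f_equal; ring).
    apply is_lim_seq_plus'; [apply is_lim_seq_const|exact Hr0]. }
replace (Finite (/ s)) with (Rbar_mult (/ s) 1) by (simpl; f_equal; ring).
apply is_lim_seq_scal_l.
replace (Finite 1) with (Rbar_mult 1 1) by (simpl; f_equal; ring).
now apply is_lim_seq_mult'.
Qed.

Lemma is_agm_normalize (a b M : R) : 0 < a -> 0 <= b -> is_agm a b M -> is_agm 1 (b / a) (M / a).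
Proof.
intros Ha Hb H; apply (is_agm_scal (/ a)) in H; try lra.
- now replace 1 with (/ a * a) by (field; lra); replace (b / a) with (/ a * b) by apply Rmult_comm;
    replace (M / a) with (/ a * M) by apply Rmult_comm.
- now apply Rlt_le, Rinv_0_lt_compat.
Qed.

(* The two AGM limits determine the ratio [M(1, Gcsq/G0sq) / M(1, Ghsq/G0sq) = s],
   which is strictly monotone in the modulus. *)
Lemma G_inversion_aux (s : R) : 0 < s ->
  Ghsq (/ s) / G0sq (/ s) = Gcsq s / G0sq s /\ G0sq (/ s) = s * G0sq s.
Proof.
intros Hs; assert (Hs' := Rinv_0_lt_compat s Hs).
assert (HX := G0sq_pos s Hs); assert (HX' := G0sq_pos (/ s) Hs').
assert (HB := Ghsq_pos s Hs); assert (HB' := Ghsq_pos (/ s) Hs').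
assert (HY := Gcsq_ge0 s); assert (HY' := Gcsq_ge0 (/ s)).
assert (L1 := is_agm_normalize _ _ _ HX HY (is_agm_G0sq_Gcsq s Hs)).
assert (L2 := is_agm_normalize _ _ _ HX (Rlt_le _ _ HB) (is_agm_G0sq_Ghsq s Hs)).
assert (L1' := is_agm_normalize _ _ _ HX' HY' (is_agm_G0sq_Gcsq (/ s) Hs')).
assert (L2' := is_agm_normalize _ _ _ HX' (Rlt_le _ _ HB') (is_agm_G0sq_Ghsq (/ s) Hs')).
assert (E := Gcsq_sqr s Hs); assert (E' := Gcsq_sqr (/ s) Hs').
rewrite Rinv_inv in L2'.
set (X := G0sq s) in *; set (B := Ghsq s) in *; set (Y := Gcsq s) in *.
set (X' := G0sq (/ s)) in *; set (B' := Ghsq (/ s)) in *; set (Y' := Gcsq (/ s)) in *.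
assert (F : (Y / X) ^ 2 + (B / X) ^ 2 = 1)
  by (replace ((Y / X) ^ 2 + (B / X) ^ 2) with ((Y ^ 2 + B ^ 2) / X ^ 2) by (field; lra);
    rewrite E; field; lra).
assert (F' : (Y' / X') ^ 2 + (B' / X') ^ 2 = 1)
  by (replace ((Y' / X') ^ 2 + (B' / X') ^ 2) with ((Y' ^ 2 + B' ^ 2) / X' ^ 2) by (field; lra);
    rewrite E'; field; lra).
assert (Hy : 0 <= Y / X) by (apply Rle_div_r; lra).
assert (Hy' : 0 <= Y' / X') by (apply Rle_div_r; lra).
assert (Hb : 0 < B / X) by (apply Rdiv_lt_0_compat; lra).
assert (Hb' : 0 < B' / X') by (apply Rdiv_lt_0_compat; lra).
assert (P1 : 0 < 1 / X) by (apply Rdiv_lt_0_compat; lra).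
assert (P2 : 0 < / s / X) by (apply Rdiv_lt_0_compat; lra).
assert (P1' : 0 < 1 / X') by (apply Rdiv_lt_0_compat; lra).
assert (P2' : 0 < s / X') by (apply Rdiv_lt_0_compat; lra).
assert (S1 : s * (/ s / X) = 1 / X) by (field; lra).
assert (S2 : s * (1 / X') = s / X') by (field; lra).
set (y := Y / X) in *; set (b := B / X) in *; set (y' := Y' / X') in *; set (b' := B' / X') in *.
(* The moduli satisfy y^2 + b^2 = 1 and y'^2 + b'^2 = 1. If b' < y then b < y', and strict
   monotonicity gives both s / X' < 1 / X and 1 / X < s / X'; the case b' > y is symmetric. *)
assert (Hby : b' = y).
{ destruct (Rtotal_order b' y) as [H|[H|H]]; [exfalso|exact H|exfalso].
  - assert (H1 := is_agm_lt _ _ _ _ (conj (Rlt_le _ _ Hb') H) P2' L2' L1).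
    assert (Hb1 : b < y') by nra.
    assert (H2 := is_agm_lt _ _ _ _ (conj (Rlt_le _ _ Hb) Hb1) P2 L2 L1'); nra.
  - assert (H1 := is_agm_lt _ _ _ _ (conj Hy H) P1 L1 L2').
    assert (Hb1 : y' < b) by nra.
    assert (H2 := is_agm_lt _ _ _ _ (conj Hy' Hb1) P1' L1' L2); nra. }
split; [exact Hby|].
rewrite Hby in L2'.
assert (H : s / X' = 1 / X).
{ apply is_lim_seq_unique in L2', L1; rewrite L1 in L2'; congruence. }
apply (Rmult_eq_reg_r (1 / X)); [|lra]; rewrite <- H at 1; field; lra.
Qed.

Lemma G_inversion (s : R) : 0 < s -> G (/ s) 0 = sqrt s * G s 0.
Proof.
intros Hs; assert (Hs' := Rinv_0_lt_compat s Hs).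
destruct (G_inversion_aux s Hs) as [_ H]; unfold G0sq in H.
assert (H1 := G_pos s 0 Hs); assert (H2 := G_pos (/ s) 0 Hs').
assert (H3 := sqrt_lt_R0 s Hs).
rewrite <- (sqrt_pow2 (G (/ s) 0)) by lra; rewrite H, sqrt_mult, sqrt_pow2; try lra.
apply pow2_ge_0.
Qed.

(** At the fixed point s = 1 of the inversion the modulus equals its complement: [Ghsq 1 = Gcsq 1],
    written in theta values at 2. *)
Lemma G_lemniscatic :
  G 2 0 ^ 2 - G 2 (1 / 2) ^ 2 = 2 * (G 2 0 * G 2 (1 / 2)).
Proof.
destruct (G_inversion_aux 1 Rlt_0_1) as [H _]; rewrite Rinv_1 in H.
assert (HX := G0sq_pos 1 Rlt_0_1).
rewrite Gcsq_double, Ghsq_double in H by exact Rlt_0_1.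
replace (2 * 1) with 2 in H by ring; unfold G0sq at 2, Ghsq in H.
apply (Rmult_eq_reg_r (/ G0sq 1)); [symmetry; exact H|].
apply Rinv_neq_0_compat; lra.
Qed.

(** * The lemniscate sine *)

(** The constant 3 is small enough for [gauss_four_pairs], where a factor of at least 4 is
    available. *)
Lemma one_sub_pow_add_two (w : R) (k : nat) : 0 <= w <= 1 -> (0 < k)%nat ->
  1 - w ^ (k + 2) <= 3 * (1 - w ^ k).
Proof.
intros Hw Hk; rewrite pow_add.
assert (H : 0 <= w ^ (k - 1) <= 1).
{ split; [apply pow_le; lra|]; rewrite <- (pow1 (k - 1)); apply pow_incr; lra. }
replace k with (S (k - 1)) by lia; simpl.
set (v := w ^ (k - 1)) in *.
assert (H1 : 0 <= w * v <= w) by (split; [apply Rmult_le_pos|]; nra).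
assert (H2 : 0 <= w * v * (1 - w) * (1 - w)) by (repeat apply Rmult_le_pos; lra).
nra.
Qed.

(** The indices n and -(n + 1) are paired: the terms are C and A w^k on the left, A and C w^(k+2) on
    the right. The claim becomes C (1 - w^(k+2)) < A (1 - w^k), which follows from 4 C <= A and
    [one_sub_pow_add_two]. *)
Lemma gauss_four_pairs (y : R) (n : nat) : 0 <= y < 1 / 4 ->
  gauss 4 (y + 1 / 2) (Z.of_nat n) + gauss 4 (y + 1 / 2) (- Z.of_nat (S n))
  < gauss 4 y (Z.of_nat n) + gauss 4 y (- Z.of_nat (S n)).
Proof.
intros Hy; set (k := (4 * n + 1)%nat).
assert (Hpi : 3 < PI) by (assert (H := PI2_3_2); lra).
assert (Hd := Rmult_lt_0_compat PI (1 - 4 * y) ltac:(lra) ltac:(lra)).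
set (w := exp (- (PI * (1 - 4 * y)))).
assert (Hw : 0 < w < 1).
{ split; [apply exp_pos|]; apply Rlt_le_trans with (exp 0);
    [apply exp_increasing; lra|rewrite exp_0; lra]. }
assert (Hwk : forall j : nat, w ^ j = exp (- (PI * (1 - 4 * y) * INR j))).
{ intros j; unfold w; rewrite <- (Rpower_pow j) by apply exp_pos; unfold Rpower.
  rewrite ln_exp; f_equal; ring. }
assert (Hn : INR k = 4 * INR n + 1)
  by (unfold k; rewrite plus_INR, mult_INR; simpl; ring).
assert (Hk2 : INR (k + 2) = 4 * INR n + 3) by (rewrite plus_INR, Hn; simpl; ring).
assert (Hn0 := pos_INR n).
set (A := gauss 4 y (Z.of_nat n)); assert (HA : 0 < A) by apply gauss_pos.
set (C := gauss 4 (y + 1 / 2) (Z.of_nat n)); assert (HC : 0 < C) by apply gauss_pos.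
assert (EB : gauss 4 (y + 1 / 2) (- Z.of_nat (S n)) = A * w ^ k).
{ unfold A, gauss; rewrite Hwk, <- exp_plus, Hn, opp_IZR, <- !INR_IZR_INZ, S_INR.
  f_equal; field. }
assert (ED : gauss 4 y (- Z.of_nat (S n)) = C * w ^ (k + 2)).
{ unfold C, gauss; rewrite Hwk, <- exp_plus, Hk2, opp_IZR, <- !INR_IZR_INZ, S_INR.
  f_equal; field. }
(* C / A = exp(-PI (4 n + 1 + 4 y)) is at most 1/4, by exp(x) >= 1 + x and PI > 3. *)
assert (HCA : 4 * C <= A).
{ assert (E : C = A * exp (- (PI * (4 * INR n + 1 + 4 * y)))).
  { unfold A, C, gauss; rewrite <- exp_plus, <- !INR_IZR_INZ; f_equal; field. }
  assert (H : exp (- (PI * (4 * INR n + 1 + 4 * y))) <= / 4).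
  { rewrite exp_Ropp; apply Rinv_le_contravar; [lra|].
    eapply Rle_trans; [|apply exp_ineq1_le].
    assert (H := Rmult_le_compat_l PI 1 (4 * INR n + 1 + 4 * y) ltac:(lra) ltac:(lra)); lra. }
  nra. }
assert (Hp := one_sub_pow_add_two w k ltac:(lra) ltac:(unfold k; lia)).
assert (Hwk1 : 0 < 1 - w ^ k).
{ assert (H := pow_lt_1_compat w k ltac:(lra) ltac:(unfold k; lia)); lra. }
rewrite EB, ED; nra.
Qed.

Lemma G_four_half_lt_nonneg (y : R) : 0 <= y < 1 / 4 -> G 4 (y + 1 / 2) < G 4 y.
Proof.
intros Hy.
destruct (ex_BiSeries_gauss 4 y ltac:(lra)) as [H1 H2].
destruct (ex_BiSeries_gauss 4 (y + 1 / 2) ltac:(lra)) as [H3 H4].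
unfold G, BiSeries.
rewrite <- (Series_plus _ _ H1 H2), <- (Series_plus _ _ H3 H4).
assert (H12 : ex_series (fun n => gauss 4 y (Z.of_nat n) + gauss 4 y (- Z.of_nat (S n))))
  by exact (ex_series_plus _ _ H1 H2).
assert (H34 : ex_series (fun n =>
    gauss 4 (y + 1 / 2) (Z.of_nat n) + gauss 4 (y + 1 / 2) (- Z.of_nat (S n))))
  by exact (ex_series_plus _ _ H3 H4).
apply Rlt_0_minus; rewrite <- (Series_minus _ _ H12 H34).
eapply Rlt_le_trans; [|apply (sum_n_le_Series _ 0)].
- rewrite sum_O; assert (Hp := gauss_four_pairs y 0 Hy); lra.
- intros n; assert (Hp := gauss_four_pairs y n Hy); lra.
- exact (ex_series_minus _ _ H12 H34).
Qed.

Lemma G_four_half_lt (y : R) : - (1 / 4) < y < 1 / 4 -> G 4 (y + 1 / 2) < G 4 y.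
Proof.
intros Hy; destruct (Rle_dec 0 y); [apply G_four_half_lt_nonneg; lra|].
rewrite <- (G_opp 4 y), <- (G_opp 4 (y + 1 / 2)), <- (G_shift 4 (- (y + 1 / 2))) by lra.
replace (- (y + 1 / 2) + 1) with (- y + 1 / 2) by lra.
apply G_four_half_lt_nonneg; lra.
Qed.

(** By [G_mul] with the arguments [X] and [Y], the right side minus the left factors as (G 4 X - G 4
    (X + 1/2)) (G 4 Y - G 4 (Y + 1/2)), and both [X] and [Y] lie in (-1/4, 1/4). *)
Lemma G_two_cross (x y : R) : 0 <= y -> y < x -> x <= 1 / 2 ->
  G 2 x * G 2 (y + 1 / 2) < G 2 (x + 1 / 2) * G 2 y.
Proof.
intros Hy Hyx Hx.
set (X := (x - 1 / 2 + y) / 2); set (Y := (x - 1 / 2 - y) / 2).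
assert (HX := G_four_half_lt X ltac:(unfold X; lra)).
assert (HY := G_four_half_lt Y ltac:(unfold Y; lra)).
assert (E1 := G_mul 2 X Y ltac:(lra)); assert (E2 := G_mul 2 X (Y + 1 / 2) ltac:(lra)).
replace (2 * 2) with 4 in E1, E2 by ring.
replace (Y + 1 / 2 + 1 / 2) with (Y + 1) in E2 by lra; rewrite (G_shift 4 Y) in E2 by lra.
replace (X + (Y + 1 / 2)) with x in E2 by (unfold X, Y; field).
replace (X - (Y + 1 / 2)) with (y - 1 / 2) in E2 by (unfold X, Y; field).
replace (X + Y) with (x - 1 / 2) in E1 by (unfold X, Y; field).
replace (X - Y) with y in E1 by (unfold X, Y; field).
rewrite <- (G_shift 2 (y - 1 / 2)) in E2 by lra.
rewrite <- (G_shift 2 (x - 1 / 2)) in E1 by lra.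
replace (y - 1 / 2 + 1) with (y + 1 / 2) in E2 by lra.
replace (x - 1 / 2 + 1) with (x + 1 / 2) in E1 by lra.
rewrite E1, E2; nra.
Qed.

(* The square of the lemniscate sine, its period scaled to 1: the quotient
   theta_1^2 / theta_3^2 at tau = i. *)
Definition slsq (x : R) : R :=
  (G 2 0 * G 2 (x + 1 / 2) - G 2 (1 / 2) * G 2 x) /
  (G 2 0 * G 2 x + G 2 (1 / 2) * G 2 (x + 1 / 2)).

Definition gratio (x : R) : R := G 1 x / G 1 0.

Definition sldup (s : R) : R := 4 * s * (1 - s ^ 2) / (1 + s ^ 2) ^ 2.

Lemma G_two_pos (x : R) : 0 < G 2 x.
Proof. apply G_pos; lra. Qed.

Lemma G_one_sqr (x : R) :
  G 1 x ^ 2 = G 2 0 * G 2 x + G 2 (1 / 2) * G 2 (x + 1 / 2).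
Proof.
assert (H := G_mul 1 x 0 Rlt_0_1).
rewrite Rplus_0_r, Rminus_0_r, Rplus_0_l, Rmult_1_r in H; lra.
Qed.

Lemma G_one_double (x : R) : G 1 (2 * x) * G 1 0 = G 2 x ^ 2 + G 2 (x + 1 / 2) ^ 2.
Proof.
assert (H := G_mul 1 x x Rlt_0_1).
rewrite Rminus_diag, Rmult_1_r in H; replace (x + x) with (2 * x) in H by ring; lra.
Qed.

Lemma G_one_double_half (x : R) :
  G 1 (2 * x + 1 / 2) * G 1 (1 / 2) = 2 * (G 2 x * G 2 (x + 1 / 2)).
Proof.
assert (H := G_mul 1 (x + 1 / 2) x Rlt_0_1).
replace (x + 1 / 2 + 1 / 2) with (x + 1) in H by lra.
rewrite Rmult_1_r, (G_shift 2 x) in H by lra.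
replace (x + 1 / 2 + x) with (2 * x + 1 / 2) in H by ring.
replace (x + 1 / 2 - x) with (1 / 2) in H by ring; lra.
Qed.

Lemma G_opp_half (x : R) : G 2 (- x + 1 / 2) = G 2 (x + 1 / 2).
Proof.
rewrite <- (G_opp 2 (x + 1 / 2)), <- (G_shift 2 (- (x + 1 / 2))) by lra; f_equal; lra.
Qed.

Lemma slsq_opp (x : R) : slsq (- x) = slsq x.
Proof. unfold slsq; rewrite G_opp_half, G_opp by lra; reflexivity. Qed.

Lemma slsq_shift (x : R) : slsq (x + 1) = slsq x.
Proof.
unfold slsq; replace (x + 1 + 1 / 2) with (x + 1 / 2 + 1) by lra.
rewrite !G_shift by lra; reflexivity.
Qed.

Lemma gratio_opp (x : R) : gratio (- x) = gratio x.
Proof. unfold gratio; rewrite G_opp by lra; reflexivity. Qed.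

Lemma gratio_shift (x : R) : gratio (x + 1) = gratio x.
Proof. unfold gratio; rewrite G_shift by lra; reflexivity. Qed.

Lemma gratio_pos (x : R) : 0 < gratio x.
Proof. apply Rdiv_lt_0_compat; apply G_pos; lra. Qed.

(** With N and M the numerator and denominator of [slsq x], one has [G 1 x ^ 2 = M] and M^2 + N^2 =
    (a^2 + b^2)(P^2 + Q^2). *)
Lemma gratio_double (x : R) : gratio (2 * x) = gratio x ^ 4 * (1 + slsq x ^ 2).
Proof.
assert (H0 := G_pos 1 0 ltac:(lra)).
assert (Ha := G_two_pos 0); assert (Hb := G_two_pos (1 / 2)).
assert (HP := G_two_pos x); assert (HQ := G_two_pos (x + 1 / 2)).
unfold gratio.
replace ((G 1 x / G 1 0) ^ 4) with ((G 1 x ^ 2) ^ 2 / (G 1 0 ^ 2) ^ 2) by (field; lra).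
replace (G 1 (2 * x) / G 1 0) with (G 1 (2 * x) * G 1 0 / G 1 0 ^ 2) by (field; lra).
rewrite G_one_double, (G_one_sqr x), (G_one_sqr 0), Rplus_0_l; unfold slsq.
set (a := G 2 0) in *; set (b := G 2 (1 / 2)) in *.
set (P := G 2 x) in *; set (Q := G 2 (x + 1 / 2)) in *.
field; split; nra.
Qed.

(** Squaring the duplication formulas for [G 1] expresses the theta values at 2 x by those at x;
    [G_lemniscatic] enters as a b = d / 2 and D^2 = 2 d^2. *)
Lemma slsq_double (x : R) : slsq (2 * x) = sldup (slsq x).
Proof.
assert (H0 := G_pos 1 0 ltac:(lra)); assert (H1 := G_pos 1 (1 / 2) ltac:(lra)).
assert (Ha := G_two_pos 0); assert (Hb := G_two_pos (1 / 2)).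
assert (HP := G_two_pos x); assert (HQ := G_two_pos (x + 1 / 2)).
assert (HP' := G_two_pos (2 * x)); assert (HQ' := G_two_pos (2 * x + 1 / 2)).
assert (HL := G_lemniscatic).
assert (E1 : (G 1 (2 * x) * G 1 0) ^ 2 = (G 2 x ^ 2 + G 2 (x + 1 / 2) ^ 2) ^ 2)
  by (now rewrite G_one_double).
assert (E2 : (G 1 (2 * x + 1 / 2) * G 1 (1 / 2)) ^ 2 = (2 * (G 2 x * G 2 (x + 1 / 2))) ^ 2)
  by (now rewrite G_one_double_half).
rewrite Rpow_mult_distr, !G_one_sqr, Rplus_0_l in E1.
rewrite Rpow_mult_distr, !G_one_sqr in E2.
replace (2 * x + 1 / 2 + 1 / 2) with (2 * x + 1) in E2 by lra.
replace (1 / 2 + 1 / 2) with (0 + 1) in E2 by lra.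
rewrite !G_shift in E2 by lra.
unfold slsq, sldup.
set (a := G 2 0) in *; set (b := G 2 (1 / 2)) in *.
set (P := G 2 x) in *; set (Q := G 2 (x + 1 / 2)) in *.
set (P' := G 2 (2 * x)) in *; set (Q' := G 2 (2 * x + 1 / 2)) in *.
set (d := a ^ 2 - b ^ 2) in *.
assert (Hd : 0 < d) by nra.
assert (Hab : a * b = d / 2) by lra.
assert (HD2 : (a ^ 2 + b ^ 2) ^ 2 = 2 * d ^ 2)
  by (replace ((a ^ 2 + b ^ 2) ^ 2) with (d ^ 2 + 4 * (a * b) ^ 2) by (unfold d; ring);
    rewrite Hab; field).
assert (HD : 0 < a ^ 2 + b ^ 2) by nra.
set (D := a ^ 2 + b ^ 2) in *; set (S := P ^ 2 + Q ^ 2) in *.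
assert (HS : 0 < S) by (unfold S; nra).
assert (EA : a * P' + b * Q' = S ^ 2 / D)
  by (rewrite <- E1; unfold D; field; nra).
assert (EB : a * Q' + b * P' = 4 * P ^ 2 * Q ^ 2 / d).
{ apply (Rmult_eq_reg_r d); [|lra]; replace (4 * P ^ 2 * Q ^ 2 / d * d)
    with ((2 * (P * Q)) ^ 2) by (field; lra); rewrite <- E2, HL; ring. }
(* This eliminates the numerator of [slsq (2 * x)] in favour of the two combinations just computed;
   the d on the right stands for 2 a b. *)
assert (EN : (a * Q' - b * P') * d = D * (a * Q' + b * P') - d * (a * P' + b * Q')).
{ rewrite HL at 2; unfold d, D; ring. }
set (N := a * Q - b * P); set (M := a * P + b * Q).
assert (HM : 0 < M) by (unfold M; nra).
assert (ENM : N * M = d / 2 * (2 * P * Q - (P ^ 2 - Q ^ 2))).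
{ replace (N * M) with (P * Q * d - a * b * (P ^ 2 - Q ^ 2)) by (unfold N, M, d; ring).
  rewrite Hab; field. }
assert (EM2 : M ^ 2 - N ^ 2 = d * (2 * P * Q + (P ^ 2 - Q ^ 2))).
{ replace (M ^ 2 - N ^ 2) with (d * (P ^ 2 - Q ^ 2) + 4 * (a * b) * (P * Q))
    by (unfold N, M, d; ring).
  rewrite Hab; field. }
assert (EMN : M ^ 2 + N ^ 2 = D * S) by (unfold M, N, D, S; ring).
transitivity (8 * P ^ 2 * Q ^ 2 / S ^ 2 - 1).
- replace (a * Q' - b * P') with ((D * (a * Q' + b * P') - d * (a * P' + b * Q')) / d)
    by (rewrite <- EN; field; lra).
  rewrite EA, EB.
  replace ((D * (4 * P ^ 2 * Q ^ 2 / d) - d * (S ^ 2 / D)) / d / (S ^ 2 / D))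
    with (D ^ 2 / d ^ 2 * (4 * P ^ 2 * Q ^ 2) / S ^ 2 - 1) by (field; lra).
  rewrite HD2; field; lra.
- replace (4 * (N / M) * (1 - (N / M) ^ 2) / (1 + (N / M) ^ 2) ^ 2)
    with (4 * (N * M) * (M ^ 2 - N ^ 2) / (M ^ 2 + N ^ 2) ^ 2) by (field; nra).
  rewrite ENM, EM2, EMN, Rpow_mult_distr, HD2.
  replace (8 * P ^ 2 * Q ^ 2 / S ^ 2 - 1)
    with ((8 * P ^ 2 * Q ^ 2 - S ^ 2) / S ^ 2) by (field; lra).
  unfold S; field; split; [|lra]; fold S; lra.
Qed.

Lemma slsq_lt (x y : R) : 0 <= y -> y < x -> x <= 1 / 2 -> slsq y < slsq x.
Proof.
intros Hy Hyx Hx; assert (H := G_two_cross x y Hy Hyx Hx).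
assert (Ha := G_two_pos 0); assert (Hb := G_two_pos (1 / 2)).
assert (HP := G_two_pos x); assert (HQ := G_two_pos (x + 1 / 2)).
assert (HP' := G_two_pos y); assert (HQ' := G_two_pos (y + 1 / 2)).
unfold slsq.
set (a := G 2 0) in *; set (b := G 2 (1 / 2)) in *.
set (P := G 2 x) in *; set (Q := G 2 (x + 1 / 2)) in *.
set (P' := G 2 y) in *; set (Q' := G 2 (y + 1 / 2)) in *.
assert (D : 0 < a * P + b * Q) by nra; assert (D' : 0 < a * P' + b * Q') by nra.
apply Rlt_0_minus.
replace ((a * Q - b * P) / (a * P + b * Q) - (a * Q' - b * P') / (a * P' + b * Q'))
  with ((a ^ 2 + b ^ 2) * (Q * P' - P * Q') / ((a * P + b * Q) * (a * P' + b * Q')))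
  by (field; lra).
apply Rdiv_lt_0_compat; [|nra].
apply Rmult_lt_0_compat; nra.
Qed.

Lemma slsq_0 : slsq 0 = 0.
Proof. unfold slsq; rewrite Rplus_0_l; unfold Rdiv; ring. Qed.

Lemma slsq_half : slsq (1 / 2) = 1.
Proof.
assert (Ha := G_two_pos 0); assert (Hb := G_two_pos (1 / 2)); assert (HL := G_lemniscatic).
unfold slsq; rewrite G_shift_half by lra.
set (a := G 2 0) in *; set (b := G 2 (1 / 2)) in *.
replace (a * a - b * b) with (a * b + b * a) by lra; field; nra.
Qed.

(** At 1/4 the two theta values agree by symmetry, leaving (a - b)/(a + b), and [G_lemniscatic]
    gives a = (1 + sqrt 2) b. This value is the critical point of [sldup] in (0, 1), which separates
    its monotone branches. *)
Lemma slsq_quarter : slsq (1 / 4) = sqrt 2 - 1.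
Proof.
assert (Ha := G_two_pos 0); assert (Hb := G_two_pos (1 / 2)); assert (HL := G_lemniscatic).
assert (HP := G_two_pos (1 / 4)).
assert (EQ : G 2 (1 / 4 + 1 / 2) = G 2 (1 / 4)).
{ rewrite <- G_opp, <- G_shift by lra; f_equal; lra. }
unfold slsq; rewrite EQ.
set (a := G 2 0) in *; set (b := G 2 (1 / 2)) in *; set (P := G 2 (1 / 4)) in *.
assert (Hs := sqrt_sqrt 2 ltac:(lra)); assert (Hs0 := sqrt_lt_R0 2 ltac:(lra)).
assert (E : a = (1 + sqrt 2) * b).
{ assert (H : (a - (1 + sqrt 2) * b) * (a + (sqrt 2 - 1) * b) = 0)
    by (replace ((a - (1 + sqrt 2) * b) * (a + (sqrt 2 - 1) * b))
      with (a ^ 2 - 2 * (a * b) - (sqrt 2 * sqrt 2 - 1) * b ^ 2) by ring; rewrite Hs; lra).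
  apply Rmult_integral in H; destruct H as [H|H]; [lra|].
  assert (1 < sqrt 2) by (rewrite <- sqrt_1; apply sqrt_lt_1_alt; lra); nra. }
rewrite E; apply (Rmult_eq_reg_r (((1 + sqrt 2) * b * P + b * P))); [|nra].
unfold Rdiv; rewrite Rmult_assoc, Rinv_l by nra.
replace ((sqrt 2 - 1) * ((1 + sqrt 2) * b * P + b * P))
  with (b * P * (sqrt 2 * sqrt 2 + sqrt 2 - 2)) by ring; rewrite Hs; ring.
Qed.

(** * Three-cycles of the duplication map *)

(* The inverse of [slsq], up to an affine change of variable; [sldup] becomes
   multiplication by 2 or -2 in this coordinate. *)
Definition slint (x : R) : R := RInt (fun s => / sqrt (s * (1 - s ^ 2))) (1 / 2) x.

Lemma slint_radicand_pos (s : R) : 0 < s < 1 -> 0 < s * (1 - s ^ 2).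
Proof. intros Hs; apply Rmult_lt_0_compat; nra. Qed.

Lemma is_derive_slint (x : R) : 0 < x < 1 -> is_derive slint x (/ sqrt (x * (1 - x ^ 2))).
Proof.
intros Hx.
assert (Hc : forall s, 0 < s < 1 -> continuous (fun s => / sqrt (s * (1 - s ^ 2))) s).
{ intros s Hs; assert (H := slint_radicand_pos s Hs).
  apply (ex_derive_continuous (fun s => / sqrt (s * (1 - s ^ 2)))); auto_derive.
  simpl in H; split; [lra|split; [|exact I]]; apply Rgt_not_eq, sqrt_lt_R0; lra. }
apply (is_derive_RInt (fun s => / sqrt (s * (1 - s ^ 2))) slint (1 / 2)); [|now apply Hc].
assert (Hr : 0 < Rmin x (1 - x)) by (apply Rmin_glb_lt; lra).
exists (mkposreal _ Hr); intros y Hy.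
apply (@RInt_correct R_CompleteNormedModule), (@ex_RInt_continuous R_CompleteNormedModule).
intros z Hz; apply Hc.
unfold ball in Hy; simpl in Hy; unfold AbsRing_ball, abs, minus, plus, opp in Hy; simpl in Hy.
apply Rabs_lt_between in Hy.
assert (H1 := Rmin_l x (1 - x)); assert (H2 := Rmin_r x (1 - x)).
split.
- eapply Rlt_le_trans; [|apply Hz]; apply Rmin_glb_lt; lra.
- eapply Rle_lt_trans; [apply Hz|]; apply Rmax_lub_lt; lra.
Qed.

Lemma slint_inj (x y : R) : 0 < x < 1 -> 0 < y < 1 -> slint x = slint y -> x = y.
Proof.
assert (H : forall x y, 0 < x < 1 -> 0 < y < 1 -> x < y -> slint x < slint y).
{ intros a b Ha Hb Hab.
  destruct (MVT_gen slint a b (fun s => / sqrt (s * (1 - s ^ 2)))) as (c & Hc & E).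
  - intros z; rewrite Rmin_left, Rmax_right by lra; intros Hz; apply is_derive_slint; lra.
  - intros z; rewrite Rmin_left, Rmax_right by lra; intros Hz.
    apply derivable_continuous_pt; eexists; apply is_derive_Reals, is_derive_slint; lra.
  - rewrite Rmin_left, Rmax_right in Hc by lra.
    assert (Hp : 0 < / sqrt (c * (1 - c ^ 2)))
      by (apply Rinv_0_lt_compat, sqrt_lt_R0, slint_radicand_pos; lra).
    nra. }
intros Hx Hy E; destruct (Rtotal_order x y) as [L|[L|L]]; [|exact L|];
  apply H in L; lra.
Qed.

(** The factor s^2 + 2 s - 1 changes sign at sqrt 2 - 1 and tells the two branches of [sldup] apart;
    the factor 1 + 2 s - s^2 is positive on (0, 1). *)
Lemma one_sub_sldup_sqr (s : R) :
  1 - sldup s ^ 2 = ((s ^ 2 + 2 * s - 1) * (1 + 2 * s - s ^ 2) / (1 + s ^ 2) ^ 2) ^ 2.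
Proof. unfold sldup; assert (H := one_plus_sq_pos s); field; lra. Qed.

Lemma sldup_bounds (s : R) : 0 < s < 1 -> s ^ 2 + 2 * s - 1 <> 0 -> 0 < sldup s < 1.
Proof.
intros Hs Hw; assert (H := one_plus_sq_pos s).
assert (H0 : 0 < sldup s).
{ apply Rdiv_lt_0_compat; [|now apply pow_lt].
  rewrite Rmult_assoc; assert (H1 := slint_radicand_pos s Hs); lra. }
split; [exact H0|].
assert (H1 : 0 < 1 - sldup s ^ 2); [|nra].
rewrite one_sub_sldup_sqr; apply pow2_gt_0.
apply Rmult_integral_contrapositive_currified; [|apply Rinv_neq_0_compat, pow_nonzero; lra].
apply Rmult_integral_contrapositive_currified; [exact Hw|nra].
Qed.

Lemma is_derive_sldup (s : R) :
  is_derive sldup s (- 4 * ((s ^ 2 + 2 * s - 1) * (1 + 2 * s - s ^ 2)) / (1 + s ^ 2) ^ 3).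
Proof.
assert (H := one_plus_sq_pos s); unfold sldup; auto_derive.
- simpl in H; apply Rgt_not_eq; repeat apply Rmult_lt_0_compat; lra.
- simpl in H; field; simpl; lra.
Qed.

(** The number [e] is the sign of s^2 + 2 s - 1, so both branches are treated at once. The
    differential ds / sqrt(s (1 - s^2)) is multiplied by 2, with sign -e because [sldup] decreases
    where e = 1. *)
Lemma is_derive_slint_sldup (e s : R) : 0 < s < 1 -> e ^ 2 = 1 ->
  0 < e * (s ^ 2 + 2 * s - 1) ->
  is_derive (fun s => slint (sldup s)) s (- (2 * e) / sqrt (s * (1 - s ^ 2))).
Proof.
intros Hs He Hw; assert (Hv : 0 < 1 + 2 * s - s ^ 2) by (clear Hw; nra).
assert (H := one_plus_sq_pos s).
assert (Hr := slint_radicand_pos s Hs); assert (Hr' := sqrt_lt_R0 _ Hr).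
assert (Hd : 0 < sldup s < 1) by (apply sldup_bounds; [exact Hs|intros E; rewrite E in Hw; lra]).
assert (E : sqrt (sldup s * (1 - sldup s ^ 2)) =
  2 * sqrt (s * (1 - s ^ 2)) * (e * (s ^ 2 + 2 * s - 1) * (1 + 2 * s - s ^ 2)) / (1 + s ^ 2) ^ 3).
{ apply sqrt_lem_1.
  - apply Rlt_le, slint_radicand_pos, Hd.
  - apply Rlt_le, Rdiv_lt_0_compat; [|now apply pow_lt].
    apply Rmult_lt_0_compat; [|apply Rmult_lt_0_compat]; lra.
  - rewrite one_sub_sldup_sqr; unfold sldup.
    set (r := sqrt (s * (1 - s ^ 2))) in *.
    replace (2 * r * (e * (s ^ 2 + 2 * s - 1) * (1 + 2 * s - s ^ 2)) / (1 + s ^ 2) ^ 3 *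
      (2 * r * (e * (s ^ 2 + 2 * s - 1) * (1 + 2 * s - s ^ 2)) / (1 + s ^ 2) ^ 3))
      with (4 * (r * r) * e ^ 2 * ((s ^ 2 + 2 * s - 1) * (1 + 2 * s - s ^ 2)) ^ 2 / (1 + s ^ 2) ^ 6)
      by (field; lra).
    unfold r; rewrite sqrt_sqrt, He by lra; field; lra. }
evar_last.
{ apply (is_derive_comp slint sldup); [apply is_derive_slint, Hd|apply is_derive_sldup]. }
match goal with |- _ = ?b => change (- 4 * ((s ^ 2 + 2 * s - 1) * (1 + 2 * s - s ^ 2))
  / (1 + s ^ 2) ^ 3 * / sqrt (sldup s * (1 - sldup s ^ 2)) = b) end.
rewrite E.
assert (He0 : e <> 0) by (intros E0; rewrite E0 in He; lra).
replace (- (2 * e)) with (- 2 * e ^ 2 / e) by (field; exact He0); rewrite He.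
field; repeat split; try lra; intros E0; rewrite E0 in Hw; lra.
Qed.

Lemma slint_sldup_diff (e x y : R) : e ^ 2 = 1 -> 0 < x < 1 -> 0 < y < 1 ->
  0 < e * (x ^ 2 + 2 * x - 1) -> 0 < e * (y ^ 2 + 2 * y - 1) ->
  slint (sldup y) - slint (sldup x) = - (2 * e) * (slint y - slint x).
Proof.
intros He.
assert (Hlt : forall x y, 0 < x < 1 -> 0 < y < 1 -> x < y ->
  0 < e * (x ^ 2 + 2 * x - 1) -> 0 < e * (y ^ 2 + 2 * y - 1) ->
  slint (sldup y) - slint (sldup x) = - (2 * e) * (slint y - slint x)).
{ clear x y; intros x y Hx Hy Hxy Ex Ey.
  assert (E : slint (sldup x) + 2 * e * slint x = slint (sldup y) + 2 * e * slint y); [|lra].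
  apply (eq_is_derive (fun s => slint (sldup s) + 2 * e * slint s) x y); [|exact Hxy].
  intros t Ht; assert (Ht1 : 0 < t < 1) by lra.
  (* The sign is the same throughout [x, y], as s^2 + 2 s is monotone there. *)
  assert (Et : 0 < e * (t ^ 2 + 2 * t - 1)).
  { assert (He1 : (e - 1) * (e + 1) = 0) by lra.
    assert (Hxt : x * x <= t * t <= y * y) by (split; apply Rmult_le_compat; lra).
    apply Rmult_integral in He1; destruct He1 as [He1|He1].
    - replace e with 1 in * by lra; lra.
    - replace e with (-1) in * by lra; lra. }
  evar_last.
  - apply (is_derive_plus (fun s => slint (sldup s))).
    + apply (is_derive_slint_sldup e t Ht1 He Et).
    + apply (is_derive_scal slint t (2 * e)), (is_derive_slint t Ht1).
  - match goal with |- _ = ?b => change (- (2 * e) / sqrt (t * (1 - t ^ 2))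
      + 2 * e * / sqrt (t * (1 - t ^ 2)) = 0) end.
    field; apply Rgt_not_eq, sqrt_lt_R0, slint_radicand_pos, Ht1. }
intros Hx Hy Ex Ey; destruct (Rtotal_order x y) as [L|[->|L]].
- now apply Hlt.
- ring.
- assert (H := Hlt y x Hy Hx L Ey Ex); lra.
Qed.

(** Once around the cycle the difference of the [slint] coordinates is multiplied by 2 (-2) (-2) = 8
    and returns to itself, so it vanishes. *)
Lemma sldup_three_cycle_unique (x y : R) :
  0 < x < 1 -> 0 < sldup x < 1 -> 0 < sldup (sldup x) < 1 ->
  0 < y < 1 -> 0 < sldup y < 1 -> 0 < sldup (sldup y) < 1 ->
  x ^ 2 + 2 * x < 1 -> 1 < sldup x ^ 2 + 2 * sldup x ->
  1 < sldup (sldup x) ^ 2 + 2 * sldup (sldup x) ->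
  y ^ 2 + 2 * y < 1 -> 1 < sldup y ^ 2 + 2 * sldup y ->
  1 < sldup (sldup y) ^ 2 + 2 * sldup (sldup y) ->
  sldup (sldup (sldup x)) = x -> sldup (sldup (sldup y)) = y -> x = y.
Proof.
intros Hx Hx2 Hx3 Hy Hy2 Hy3 Lx Rx2 Rx3 Ly Ry2 Ry3 Cx Cy.
apply slint_inj; [assumption..|].
assert (E1 := slint_sldup_diff (-1) x y ltac:(ring) Hx Hy ltac:(lra) ltac:(lra)).
assert (E2 := slint_sldup_diff 1 _ _ ltac:(ring) Hx2 Hy2 ltac:(lra) ltac:(lra)).
assert (E3 := slint_sldup_diff 1 _ _ ltac:(ring) Hx3 Hy3 ltac:(lra) ltac:(lra)).
rewrite Cx, Cy in E3; lra.
Qed.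

(** * Explicit algebraic numbers *)

Definition root28 : R := sqrt 2 * Rpower 7 (1 / 4).
Definition cos7 : R := 2 * cos (2 * PI / 7).

Lemma root28_sqr : root28 ^ 2 = 2 * sqrt 7.
Proof.
unfold root28; rewrite Rpow_mult_distr, pow2_sqrt by lra; f_equal.
simpl; rewrite Rmult_1_r, <- Rpower_plus, <- Rpower_sqrt by lra; f_equal; lra.
Qed.

Lemma root28_pow4 : root28 ^ 4 = 28.
Proof.
replace (root28 ^ 4) with ((root28 ^ 2) ^ 2) by ring; rewrite root28_sqr.
rewrite Rpow_mult_distr, pow2_sqrt; lra.
Qed.

(** For x = 2 PI / 7, cos(3 x) = cos(4 x) because 3 x + 4 x = 2 PI; the resulting quartic in cos x
    is divided by its root 1. *)
Lemma cos7_cubic : cos7 ^ 3 = 1 + 2 * cos7 - cos7 ^ 2.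
Proof.
assert (Hpi := PI_RGT_0); unfold cos7; set (x := 2 * PI / 7); set (k := cos x).
assert (E2 : cos (2 * x) = 2 * k ^ 2 - 1) by (rewrite cos_2a_cos; unfold k; ring).
assert (S2 := sin2_cos2 x); unfold Rsqr in S2; fold k in S2.
assert (E3 : cos (3 * x) = 4 * k ^ 3 - 3 * k).
{ replace (3 * x) with (2 * x + x) by ring; rewrite cos_plus, E2, sin_2a; fold k.
  replace (2 * sin x * k * sin x) with (2 * k * (sin x * sin x)) by ring.
  replace (sin x * sin x) with (1 - k * k) by lra; ring. }
assert (E4 : cos (4 * x) = 2 * (2 * k ^ 2 - 1) ^ 2 - 1)
  by (replace (4 * x) with (2 * (2 * x)) by ring; rewrite cos_2a_cos, E2; ring).
assert (E : cos (3 * x) = cos (4 * x)).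
{ rewrite <- cos_neg, <- (cos_period _ 1); f_equal; unfold x; simpl; field. }
rewrite E3, E4 in E.
assert (Hk : k < 1).
{ rewrite <- cos_0; apply cos_decreasing_1; unfold x; lra. }
apply (Rmult_eq_reg_r (k - 1)); [|lra]; nra.
Qed.

Lemma cos_pi_7 : cos (PI / 7) = (cos7 ^ 2 + cos7 - 1) / 2.
Proof.
assert (H := cos7_cubic); unfold cos7 in *; set (x := 2 * PI / 7) in *.
assert (S2 := sin2_cos2 x); unfold Rsqr in S2.
replace (PI / 7) with (- (3 * x) + PI) by (unfold x; field).
rewrite neg_cos, cos_neg; replace (3 * x) with (2 * x + x) by ring.
rewrite cos_plus, cos_2a_cos, sin_2a.
replace (2 * sin x * cos x * sin x) with (2 * cos x * (sin x * sin x)) by ring.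
replace (sin x * sin x) with (1 - cos x * cos x) by lra.
lra.
Qed.

Lemma cos7_bounds : 1.2469 < cos7 < 1.247.
Proof.
assert (H := cos7_cubic).
assert (H0 : 0 < cos7).
{ assert (Hpi := PI_RGT_0); apply Rmult_lt_0_compat; [lra|apply cos_gt_0; lra]. }
split; apply Rnot_le_lt; intros Hc; nra.
Qed.

Lemma root28_bounds : 2.3003 < root28 < 2.3004.
Proof.
assert (H := root28_pow4).
assert (H0 : 0 < root28) by (apply Rmult_lt_0_compat; [apply sqrt_lt_R0; lra|apply exp_pos]).
split; apply Rnot_le_lt; intros Hc.
- assert (H1 := pow_incr root28 2.3003 4 ltac:(lra)); lra.
- assert (H1 := pow_incr 2.3004 root28 4 ltac:(lra)); lra.
Qed.

(* [alpha], [beta], [gamma] are conjugate over the field of [root28]: they are the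
   values of this polynomial at [2 cos(2 pi/7)], [2 cos(6 pi/7)], [2 cos(4 pi/7)]. *)
Definition alpha_poly (t c : R) : R :=
  2 + 3 * t - t * c ^ 2
  + t ^ 2 * (- 2 + 2 * c + 3 * c ^ 2) / 7 + t ^ 3 * (3 + c ^ 2) / 14.

Lemma sqrt7_root28 : sqrt 7 = root28 ^ 2 / 2.
Proof. rewrite root28_sqr; field. Qed.

Lemma inv_sqrt7_root28 : 1 / sqrt 7 = root28 ^ 2 / 14.
Proof.
assert (H := sqrt_lt_R0 7 ltac:(lra)); apply (Rmult_eq_reg_r (sqrt 7)); [|lra].
replace (1 / sqrt 7 * sqrt 7) with 1 by (field; lra).
rewrite sqrt7_root28; replace (root28 ^ 2 / 14 * (root28 ^ 2 / 2)) with (root28 ^ 4 / 28) by field.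
rewrite root28_pow4; field.
Qed.

Lemma p_root28 : p = root28 ^ 2 / 2 + root28 + 1.
Proof. unfold p; fold root28; now rewrite sqrt7_root28. Qed.

Lemma alpha_root28 : alpha = alpha_poly root28 cos7.
Proof.
unfold alpha; rewrite !(Rmult_assoc 3 (sqrt 2)); fold root28.
rewrite inv_sqrt7_root28, sqrt7_root28, cos_pi_7.
replace (cos (2 * PI / 7)) with (cos7 / 2) by (unfold cos7; field).
assert (Ht := root28_pow4); assert (Hc := cos7_cubic).
set (t := root28) in *; set (c := cos7) in *; unfold alpha_poly.
field [Ht Hc].
Qed.

Lemma beta_root28 : beta = alpha_poly root28 (1 - cos7 - cos7 ^ 2).
Proof.
unfold beta; rewrite !(Rmult_assoc 9 (sqrt 2)); fold root28.
rewrite inv_sqrt7_root28, sqrt7_root28, cos_pi_7.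
replace (cos (2 * PI / 7)) with (cos7 / 2) by (unfold cos7; field).
assert (Ht := root28_pow4); assert (Hc := cos7_cubic).
set (t := root28) in *; set (c := cos7) in *; unfold alpha_poly.
field [Ht Hc].
Qed.

Lemma gamma_root28 : gamma = alpha_poly root28 (cos7 ^ 2 - 2).
Proof.
unfold gamma; rewrite !(Rmult_assoc 3 (sqrt 2)); fold root28.
rewrite inv_sqrt7_root28, sqrt7_root28, cos_pi_7.
replace (cos (2 * PI / 7)) with (cos7 / 2) by (unfold cos7; field).
assert (Ht := root28_pow4); assert (Hc := cos7_cubic).
set (t := root28) in *; set (c := cos7) in *; unfold alpha_poly.
field [Ht Hc].
Qed.

(* The fourth powers of the lemniscate sine at 1/7, 2/7, 3/7: for [t = root28]
   the map [c => 1 - c - c^2] permutes the roots of [c^3 + c^2 - 2 c - 1]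
   cyclically. *)
Definition slsq_sqr_poly (t c : R) : R :=
  7 + 10 * c - 12 * c ^ 2 - t * (3 + 5 * c - 5 * c ^ 2)
  + t ^ 2 * (9 + 12 * c - 17 * c ^ 2) / 7 - t ^ 3 * (7 + 9 * c - 15 * c ^ 2) / 14.

Lemma cubic_conj (c : R) : c ^ 3 = 1 + 2 * c - c ^ 2 ->
  (1 - c - c ^ 2) ^ 3 = 1 + 2 * (1 - c - c ^ 2) - (1 - c - c ^ 2) ^ 2.
Proof. intros Hc; ring [Hc]. Qed.

Lemma cubic_conj2 (c : R) : c ^ 3 = 1 + 2 * c - c ^ 2 ->
  1 - (1 - c - c ^ 2) - (1 - c - c ^ 2) ^ 2 = c ^ 2 - 2.
Proof. intros Hc; ring [Hc]. Qed.

Lemma cubic_conj3 (c : R) : c ^ 3 = 1 + 2 * c - c ^ 2 ->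
  1 - (c ^ 2 - 2) - (c ^ 2 - 2) ^ 2 = c.
Proof. intros Hc; ring [Hc]. Qed.

Lemma slsq_sqr_poly_eq (t c : R) : t ^ 4 = 28 -> c ^ 3 = 1 + 2 * c - c ^ 2 ->
  alpha_poly t c * (t ^ 2 / 2 + t + 1) * (1 + slsq_sqr_poly t c)
  = 8 * alpha_poly t (1 - c - c ^ 2).
Proof. intros Ht Hc; unfold alpha_poly, slsq_sqr_poly; field [Ht Hc]. Qed.

(** With X = s^2 the square of [sldup s] is 16 X (1 - X)^2 / (1 + X)^4, so this is one step of the
    cycle, squared and cleared of denominators. *)
Lemma slsq_sqr_poly_double (t c : R) : t ^ 4 = 28 -> c ^ 3 = 1 + 2 * c - c ^ 2 ->
  16 * slsq_sqr_poly t c * (1 - slsq_sqr_poly t c) ^ 2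
  = slsq_sqr_poly t (1 - c - c ^ 2) * (1 + slsq_sqr_poly t c) ^ 4.
Proof. intros Ht Hc; unfold slsq_sqr_poly; field [Ht Hc]. Qed.

(** The left side is a norm: the product of [alpha_poly t] over the three roots of the cubic. *)
Lemma alpha_poly_norm (t c : R) : t ^ 4 = 28 -> c ^ 3 = 1 + 2 * c - c ^ 2 ->
  alpha_poly t c * alpha_poly t (1 - c - c ^ 2) * alpha_poly t (c ^ 2 - 2)
  = (t ^ 2 / 2 + t + 1) ^ 4.
Proof. intros Ht Hc; unfold alpha_poly; field [Ht Hc]. Qed.

(** * Values at the points of order seven *)

(** Reducing the powers of [cos7] leaves at most quadratic terms, the form in which
    [parameter_bounds] estimates the value; likewise [gamma_expand]. *)
Lemma beta_expand :
  beta = 2 + root28 * (1 - cos7) + root28 ^ 2 * (6 + cos7 - 2 * cos7 ^ 2) / 7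
    + root28 ^ 3 * (5 + cos7) / 14.
Proof.
rewrite beta_root28; unfold alpha_poly; field [root28_pow4 cos7_cubic].
Qed.

Lemma gamma_expand :
  gamma = 2 + root28 * (cos7 + cos7 ^ 2) + root28 ^ 2 * (3 - 3 * cos7 - cos7 ^ 2) / 7
    + root28 ^ 3 * (6 - cos7 - cos7 ^ 2) / 14.
Proof.
rewrite gamma_root28; unfold alpha_poly; field [root28_pow4 cos7_cubic].
Qed.

Lemma parameter_bounds :
  13.17 < alpha < 13.19 /\ 9.98 < beta < 10 /\ 9.48 < gamma < 9.5 /\ 5.945 < p < 5.947.
Proof.
rewrite alpha_root28, beta_expand, gamma_expand, p_root28; unfold alpha_poly.
assert (Ht := root28_bounds); assert (Hc := cos7_bounds).
set (t := root28) in *; set (c := cos7) in *.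
(* Interval arithmetic: every monomial in t and c is enclosed separately, which leaves linear
   inequalities in the monomials. *)
assert (Hmul : forall x y a b a' b', 0 <= a -> 0 <= b -> a <= x <= a' -> b <= y <= b' ->
  a * b <= x * y <= a' * b') by (intros; split; apply Rmult_le_compat; lra).
assert (Ht2 := Hmul t t 2.3003 2.3003 2.3004 2.3004 ltac:(lra) ltac:(lra) ltac:(lra) ltac:(lra)).
assert (Hc2 := Hmul c c 1.2469 1.2469 1.247 1.247 ltac:(lra) ltac:(lra) ltac:(lra) ltac:(lra)).
assert (Ht3 := Hmul (t * t) t 5.2913 2.3003 5.2919 2.3004 ltac:(lra) ltac:(lra) ltac:(lra) ltac:(lra)).
assert (H1 := Hmul t c 2.3003 1.2469 2.3004 1.247 ltac:(lra) ltac:(lra) ltac:(lra) ltac:(lra)).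
assert (H2 := Hmul t (c * c) 2.3003 1.5547 2.3004 1.5551 ltac:(lra) ltac:(lra) ltac:(lra) ltac:(lra)).
assert (H3 := Hmul (t * t) c 5.2913 1.2469 5.2919 1.247 ltac:(lra) ltac:(lra) ltac:(lra) ltac:(lra)).
assert (H4 := Hmul (t * t) (c * c) 5.2913 1.5547 5.2919 1.5551
  ltac:(lra) ltac:(lra) ltac:(lra) ltac:(lra)).
assert (H5 := Hmul (t * t * t) c 12.1715 1.2469 12.1735 1.247
  ltac:(lra) ltac:(lra) ltac:(lra) ltac:(lra)).
assert (H6 := Hmul (t * t * t) (c * c) 12.1715 1.5547 12.1735 1.5551
  ltac:(lra) ltac:(lra) ltac:(lra) ltac:(lra)).
repeat split; lra.
Qed.

Lemma alpha_beta_gamma : alpha * beta * gamma = p ^ 4.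
Proof.
rewrite alpha_root28, beta_root28, gamma_root28, p_root28.
apply alpha_poly_norm; [apply root28_pow4|apply cos7_cubic].
Qed.

Lemma slsq_sqr_values :
  let X1 := slsq_sqr_poly root28 cos7 in
  let X2 := slsq_sqr_poly root28 (1 - cos7 - cos7 ^ 2) in
  let X3 := slsq_sqr_poly root28 (cos7 ^ 2 - 2) in
  (alpha * p * (1 + X1) = 8 * beta /\ beta * p * (1 + X2) = 8 * gamma /\
   gamma * p * (1 + X3) = 8 * alpha) /\
  16 * X1 * (1 - X1) ^ 2 = X2 * (1 + X1) ^ 4 /\
  16 * X2 * (1 - X2) ^ 2 = X3 * (1 + X2) ^ 4 /\
  16 * X3 * (1 - X3) ^ 2 = X1 * (1 + X3) ^ 4.
Proof.
intros X1 X2 X3; unfold X1, X2, X3.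
rewrite alpha_root28, beta_root28, gamma_root28, p_root28.
assert (Ht := root28_pow4); assert (Hc := cos7_cubic).
assert (Hc1 := cubic_conj _ Hc); assert (E2 := cubic_conj2 _ Hc).
assert (E3 := cubic_conj3 _ Hc); assert (Hc2 := cubic_conj _ Hc1); rewrite E2 in Hc2.
repeat split.
- now apply slsq_sqr_poly_eq.
- rewrite slsq_sqr_poly_eq, E2 by assumption; reflexivity.
- rewrite slsq_sqr_poly_eq, E3 by assumption; reflexivity.
- now apply slsq_sqr_poly_double.
- rewrite slsq_sqr_poly_double, E2 by assumption; reflexivity.
- rewrite slsq_sqr_poly_double, E3 by assumption; reflexivity.
Qed.

Lemma sldup_sqrt (X Y : R) : 0 <= X <= 1 -> 0 <= Y ->
  16 * X * (1 - X) ^ 2 = Y * (1 + X) ^ 4 -> sldup (sqrt X) = sqrt Y.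
Proof.
intros HX HY E; symmetry; apply sqrt_lem_1; unfold sldup; [exact HY| |].
- rewrite pow2_sqrt by lra; apply Rmult_le_pos.
  + assert (H := sqrt_pos X); apply Rmult_le_pos; lra.
  + apply Rlt_le, Rinv_0_lt_compat, pow_lt; lra.
- rewrite pow2_sqrt by lra.
  replace (4 * sqrt X * (1 - X) / (1 + X) ^ 2 * (4 * sqrt X * (1 - X) / (1 + X) ^ 2))
    with (16 * (sqrt X * sqrt X) * (1 - X) ^ 2 / (1 + X) ^ 4) by (field; lra).
  rewrite sqrt_sqrt, E by lra; field; lra.
Qed.

Lemma slsq_sevenths_double :
  slsq (2 / 7) = sldup (slsq (1 / 7)) /\ slsq (3 / 7) = sldup (slsq (2 / 7)) /\
  slsq (1 / 7) = sldup (slsq (3 / 7)).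
Proof.
repeat split; rewrite <- slsq_double.
- f_equal; field.
- rewrite <- slsq_opp, <- slsq_shift; f_equal; field.
- rewrite <- slsq_opp, <- slsq_shift; f_equal; field.
Qed.

(** [slsq] increases on [0, 1/2] and takes the critical value sqrt 2 - 1 at 1/4, between 1/7 and
    2/7: the branches visited are left, right, right. *)
Lemma slsq_sevenths_order :
  0 < slsq (1 / 7) /\ slsq (1 / 7) < sqrt 2 - 1 /\ sqrt 2 - 1 < slsq (2 / 7) /\
  slsq (2 / 7) < slsq (3 / 7) /\ slsq (3 / 7) < 1.
Proof.
assert (H1 := slsq_lt (1 / 7) 0 ltac:(lra) ltac:(lra) ltac:(lra)).
assert (H2 := slsq_lt (1 / 4) (1 / 7) ltac:(lra) ltac:(lra) ltac:(lra)).
assert (H3 := slsq_lt (2 / 7) (1 / 4) ltac:(lra) ltac:(lra) ltac:(lra)).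
assert (H4 := slsq_lt (3 / 7) (2 / 7) ltac:(lra) ltac:(lra) ltac:(lra)).
assert (H5 := slsq_lt (1 / 2) (3 / 7) ltac:(lra) ltac:(lra) ltac:(lra)).
rewrite slsq_0 in H1; rewrite slsq_quarter in H2, H3; rewrite slsq_half in H5; auto.
Qed.

Lemma sqrt_bounds (X a b : R) : 0 <= a -> 0 <= b -> a ^ 2 < X < b ^ 2 -> a < sqrt X < b.
Proof.
intros Ha Hb HX; split.
- rewrite <- (sqrt_pow2 a Ha); apply sqrt_lt_1_alt; assert (H := pow2_ge_0 a); lra.
- rewrite <- (sqrt_pow2 b Hb); apply sqrt_lt_1_alt; assert (H := pow2_ge_0 a); lra.
Qed.

(** The theta values and the square roots of the explicit numbers are 3-cycles of [sldup] on the
    same branches, hence equal. *)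
Lemma slsq_sevenths_sqr :
  alpha * p * (1 + slsq (1 / 7) ^ 2) = 8 * beta /\
  beta * p * (1 + slsq (2 / 7) ^ 2) = 8 * gamma /\
  gamma * p * (1 + slsq (3 / 7) ^ 2) = 8 * alpha.
Proof.
destruct slsq_sqr_values as ((E1 & E2 & E3) & D1 & D2 & D3).
set (X1 := slsq_sqr_poly root28 cos7) in *.
set (X2 := slsq_sqr_poly root28 (1 - cos7 - cos7 ^ 2)) in *.
set (X3 := slsq_sqr_poly root28 (cos7 ^ 2 - 2)) in *.
destruct parameter_bounds as (Ha & Hb & Hg & Hp).
assert (Hap : 78.2 < alpha * p < 78.5) by nra.
assert (Hbp : 59.3 < beta * p < 59.5) by nra.
assert (Hgp : 56.3 < gamma * p < 56.5) by nra.
assert (Hq : forall A X r lo hi, 0 < A -> A * (1 + X) = r ->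
  A * (1 + lo) < r < A * (1 + hi) -> lo < X < hi).
{ intros A X r lo hi HA <- [L1 L2]; apply Rmult_lt_reg_l in L1, L2; lra. }
(* The thresholds 0.4 and 0.5 lie on either side of sqrt 2 - 1. *)
assert (B1 := Hq (alpha * p) X1 (8 * beta) (0 ^ 2) (0.4 ^ 2) ltac:(lra) E1 ltac:(lra)).
assert (B2 := Hq (beta * p) X2 (8 * gamma) (0.5 ^ 2) (1 ^ 2) ltac:(lra) E2 ltac:(lra)).
assert (B3 := Hq (gamma * p) X3 (8 * alpha) (0.5 ^ 2) (1 ^ 2) ltac:(lra) E3 ltac:(lra)).
assert (S1 := sqrt_bounds X1 0 0.4 ltac:(lra) ltac:(lra) B1).
assert (S2 := sqrt_bounds X2 0.5 1 ltac:(lra) ltac:(lra) B2).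
assert (S3 := sqrt_bounds X3 0.5 1 ltac:(lra) ltac:(lra) B3).
apply sldup_sqrt in D1, D2, D3; try lra.
destruct slsq_sevenths_double as (F1 & F2 & F3).
destruct slsq_sevenths_order as (O1 & O2 & O3 & O4 & O5).
assert (HL : forall s r, 0 < s < r -> r ^ 2 + 2 * r <= 1 -> s ^ 2 + 2 * s < 1)
  by (intros s r Hs Hr; assert (H := Rmult_le_0_lt_compat s r s r); lra).
assert (HR : forall s r, 0 <= r < s -> 1 <= r ^ 2 + 2 * r -> 1 < s ^ 2 + 2 * s)
  by (intros s r Hs Hr; assert (H := Rmult_le_0_lt_compat r s r s); lra).
assert (H2 : (sqrt 2 - 1) ^ 2 + 2 * (sqrt 2 - 1) = 1)
  by (replace ((sqrt 2 - 1) ^ 2 + 2 * (sqrt 2 - 1)) with (sqrt 2 ^ 2 - 1) by ring;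
    rewrite pow2_sqrt; lra).
assert (E : slsq (1 / 7) = sqrt X1).
{ apply sldup_three_cycle_unique; rewrite ?D1, ?D2, ?D3, <- ?F1, <- ?F2, <- ?F3;
    try reflexivity; try lra.
  - apply (HL _ (sqrt 2 - 1)); lra.
  - apply (HR _ (sqrt 2 - 1)); lra.
  - apply (HR _ (sqrt 2 - 1)); lra.
  - apply (HL _ 0.4); lra.
  - apply (HR _ 0.5); lra.
  - apply (HR _ 0.5); lra. }
rewrite F2, F1, E, D1, D2, !pow2_sqrt by lra; auto.
Qed.

(** * From lemniscate values to seventh roots *)

Lemma Rpower_seventh_pow (x : R) : 0 < x -> Rpower x (1 / 7) ^ 7 = x.
Proof.
intros Hx; rewrite <- Rpower_pow, Rpower_mult by apply exp_pos.
replace (1 / 7 * INR 7) with 1 by (simpl; field); now apply Rpower_1.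
Qed.

Lemma pow_seventh_Rpower (x : R) : 0 < x -> Rpower (x ^ 7) (1 / 7) = x.
Proof.
intros Hx; rewrite <- Rpower_pow, Rpower_mult by exact Hx.
replace (INR 7 * (1 / 7)) with 1 by (simpl; field); now apply Rpower_1.
Qed.

(** If u is the seventh root for (a, b), then u^4 b / (a q) is the one for (b, g): its seventh power
    is a b^3 / q^3, and a b g = q^4. The 8 in k = 8 b / (a q) accounts for the halves, as 8 / 2^4 =
    1/2. *)
Lemma seventh_root_step (a b g q k : R) :
  0 < a -> 0 < b -> 0 < g -> 0 < q -> a * b * g = q ^ 4 -> a * q * k = 8 * b ->
  Rpower (b ^ 2 * q / g) (1 / 7) / 2 = (Rpower (a ^ 2 * q / b) (1 / 7) / 2) ^ 4 * k.
Proof.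
intros Ha Hb Hg Hq E Ek.
assert (Hx : 0 < a ^ 2 * q / b)
  by (apply Rdiv_lt_0_compat; [apply Rmult_lt_0_compat; [apply pow_lt|]|]; assumption).
assert (Hu := Rpower_seventh_pow _ Hx).
assert (Hu0 : 0 < Rpower (a ^ 2 * q / b) (1 / 7)) by apply exp_pos.
set (u := Rpower (a ^ 2 * q / b) (1 / 7)) in *.
replace k with (8 * b / (a * q)) by (rewrite <- Ek; field; lra).
replace (b ^ 2 * q / g) with ((u ^ 4 * b / (a * q)) ^ 7).
- rewrite pow_seventh_Rpower; [field; lra|].
  apply Rdiv_lt_0_compat; apply Rmult_lt_0_compat; try assumption; now apply pow_lt.
- replace ((u ^ 4 * b / (a * q)) ^ 7) with ((u ^ 7) ^ 4 * b ^ 7 / (a * q) ^ 7) by (field; lra).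
  rewrite Hu; replace g with (q ^ 4 / (a * b)) by (rewrite <- E; field; lra).
  field; lra.
Qed.

(** The ratio r = x1 / y1 satisfies r = r^64, since three steps raise it to the power 4^3; being
    positive, it is 1. *)
Lemma quartic_cycle_unique (k1 k2 k3 x1 x2 x3 y1 y2 y3 : R) :
  0 < x1 -> 0 < x2 -> 0 < x3 -> 0 < y1 -> 0 < y2 -> 0 < y3 ->
  x2 = x1 ^ 4 * k1 -> x3 = x2 ^ 4 * k2 -> x1 = x3 ^ 4 * k3 ->
  y2 = y1 ^ 4 * k1 -> y3 = y2 ^ 4 * k2 -> y1 = y3 ^ 4 * k3 -> x1 = y1.
Proof.
intros Hx1 Hx2 Hx3 Hy1 Hy2 Hy3 X2 X3 X1 Y2 Y3 Y1.
assert (R2 : x2 / y2 = (x1 / y1) ^ 4).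
{ assert (k1 <> 0) by (intros E; rewrite E in Y2; lra); rewrite X2, Y2; field; split; lra. }
assert (R3 : x3 / y3 = (x2 / y2) ^ 4).
{ assert (k2 <> 0) by (intros E; rewrite E in Y3; lra); rewrite X3, Y3; field; split; lra. }
assert (R1 : x1 / y1 = (x3 / y3) ^ 4).
{ assert (k3 <> 0) by (intros E; rewrite E in Y1; lra); rewrite X1, Y1; field; split; lra. }
assert (Hr : 0 < x1 / y1) by now apply Rdiv_lt_0_compat.
rewrite R3, R2, <- !pow_mult in R1; set (r := x1 / y1) in *.
assert (E : r ^ 63 = 1).
{ apply (Rmult_eq_reg_l r); [|lra]; rewrite Rmult_1_r; symmetry; exact R1. }
assert (H : r = 1).
{ destruct (Rtotal_order r 1) as [L|[L|L]]; [|exact L|].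
  - assert (H := pow_lt_1_compat r 63 ltac:(lra) ltac:(lia)); lra.
  - assert (H := Rlt_pow_R1 r 63 L ltac:(lia)); lra. }
apply (Rmult_eq_reg_r (/ y1)); [|apply Rinv_neq_0_compat; lra].
rewrite Rinv_r by lra; exact H.
Qed.

Lemma gratio_sevenths :
  gratio (1 / 7) = Rpower (alpha ^ 2 * p / beta) (1 / 7) / 2 /\
  gratio (2 / 7) = Rpower (beta ^ 2 * p / gamma) (1 / 7) / 2 /\
  gratio (3 / 7) = Rpower (gamma ^ 2 * p / alpha) (1 / 7) / 2.
Proof.
destruct slsq_sevenths_sqr as (E1 & E2 & E3); assert (N := alpha_beta_gamma).
assert (Ha := alpha_pos); assert (Hb := beta_pos); assert (Hg := gamma_pos).
assert (Hp := p_pos).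
assert (U1 := seventh_root_step _ _ gamma p _ Ha Hb Hg Hp N E1).
assert (U2 := seventh_root_step _ _ alpha p _ Hb Hg Ha Hp ltac:(rewrite <- N; ring) E2).
assert (U3 := seventh_root_step _ _ beta p _ Hg Ha Hb Hp ltac:(rewrite <- N; ring) E3).
assert (V1 := gratio_double (1 / 7)); assert (V2 := gratio_double (2 / 7)).
assert (V3 := gratio_double (3 / 7)).
replace (2 * (1 / 7)) with (2 / 7) in V1 by field.
rewrite <- gratio_opp, <- gratio_shift in V2, V3.
replace (- (2 * (2 / 7)) + 1) with (3 / 7) in V2 by field.
replace (- (2 * (3 / 7)) + 1) with (1 / 7) in V3 by field.
assert (W1 := gratio_pos (1 / 7)); assert (W2 := gratio_pos (2 / 7)).
assert (W3 := gratio_pos (3 / 7)).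
assert (P : forall x y, 0 < Rpower x y / 2)
  by (intros; apply Rdiv_lt_0_compat; [apply exp_pos|lra]).
assert (E : gratio (1 / 7) = Rpower (alpha ^ 2 * p / beta) (1 / 7) / 2)
  by (eapply quartic_cycle_unique; [..|exact V1|exact V2|exact V3|exact U1|exact U2|exact U3];
    auto).
rewrite V2, V1, E; auto.
split; [reflexivity|split; [congruence|rewrite <- U1; congruence]].
Qed.

(** Inversion turns G(49, 0) into a seventh of G(1/49, 0), and splitting modulo 7 multiplies s by
    49, back to 1. The residues r and 7 - r contribute equally. *)
Lemma phi_ratio :
  phi (exp (- 49 * PI)) / phi (exp (- PI)) =
  1 / 7 * (1 + 2 * gratio (1 / 7) + 2 * gratio (2 / 7) + 2 * gratio (3 / 7)).
Proof.
replace (- PI) with (- (1 * PI)) by ring.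
replace (-49 * PI) with (- (49 * PI)) by ring; rewrite !phi_exp.
assert (H1 := G_pos 1 0 Rlt_0_1); assert (HI := G_inversion 49 ltac:(lra)).
replace (sqrt 49) with 7 in HI by (replace 49 with (7 ^ 2) by ring; now rewrite sqrt_pow2 by lra).
rewrite (G_residues (/ 49) 7) in HI by (lra || lia).
replace (/ 49 * INR 7 ^ 2) with 1 in HI by (simpl; field).
replace (INR 7) with 7 in HI by (simpl; ring); cbn [seq lsum fold_right INR] in HI.
replace (0 / 7) with 0 in HI by field.
replace (1 + 1) with 2 in HI by ring; replace (2 + 1) with 3 in HI by ring.
replace (3 + 1) with 4 in HI by ring; replace (4 + 1) with 5 in HI by ring.
replace (5 + 1) with 6 in HI by ring.
assert (S : forall x, G 1 (1 - x) = G 1 x)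
  by (intros x; rewrite <- (G_opp 1 x), <- (G_shift 1 (- x)) by lra; f_equal; ring).
replace (4 / 7) with (1 - 3 / 7) in HI by field; replace (5 / 7) with (1 - 2 / 7) in HI by field.
replace (6 / 7) with (1 - 1 / 7) in HI by field; rewrite !S in HI.
replace (G 49 0) with (1 / 7 * (7 * G 49 0)) by field; rewrite <- HI.
unfold gratio; field; lra.
Qed.

Theorem theorem7p1 :
  let u := Rpower (alpha ^ 2 * p / beta) (1/7) in
  let v := Rpower (beta ^ 2 * p / gamma) (1/7) in
  let w := Rpower (gamma ^ 2 * p / alpha) (1/7) in
  phi (exp (- 49 * PI)) / phi (exp (- PI)) = 1/7 * (1 + u + v + w).
Proof.
intros u v w; rewrite phi_ratio.
destruct gratio_sevenths as (-> & -> & ->); fold u v w; field.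
Qed.
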